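(* The $C^*$-algebra $C(X)'_*$ is the enveloping $C^*$-algebra of the involutive Banach algebra $C(X)'_1$; that is, $C(X)'_1$ is a dense $*$-subalgebra of $C(X)'_*$ and the enveloping $C^*$-norm of $C(X)'_1$ coincides with the restriction of the norm of $C(X)'_*$.
   Context: Let $X$ be a non-empty compact Hausdorff space and $\sigma:X\to X$ a homeomorphism. $C(X)$ is the algebra of continuous complex functions with sup norm, $\alpha(f)=f\circ\sigma^{-1}$. $\ell^1(\Sigma)$ is the set of $\ell:\mathbb{Z}\to C(X)$ with $\|\ell\|=\sum_k\|\ell(k)\|_\infty<\infty$, with product $(\ell\ell')(n)=\sum_k\ell(k)\alpha^k(\ell'(n-k))$ and involution $\ell^*(n)=\overline{\alpha^n(\ell(-n))}$; it is a unital Banach $*$-algebra containing $C(X)$ as the elements supported at $0$. $C^*(\Sigma)$ is the enveloping $C^*$-algebra of $\ell^1(\Sigma)$, which contains $\ell^1(\Sigma)$ as a dense $*$-subalgebra. $C(X)'_1$ and $C(X)'_*$ are the commutants of $C(X)$ in $\ell^1(\Sigma)$ and $C^*(\Sigma)$ respectively. *)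

(* Defs.v *)
From HB Require Import structures.
From mathcomp Require Import all_boot all_order all_algebra.
From mathcomp Require Import all_classical all_reals all_analysis.
From mathcomp Require Import complex.
Import Order.TTheory GRing.Theory Num.Theory.
Import numFieldTopology.Exports numFieldNormedType.Exports.

Set Implicit Arguments.
Unset Strict Implicit.
Unset Printing Implicit Defensive.

Local Open Scope classical_set_scope.
Local Open Scope ring_scope.

(* the complex numbers R[i], with their numClosedFieldType (hence topological) structure *)
Definition Cplx (R : realType) : numClosedFieldType := R[i].

Section Crossed.
Variables (R : realType) (X : topologicalType).
Variables (sigma sigmainv : X -> X).

Local Notation C := (Cplx R).

Definition cabs (z : C) : R := Num.sqrt (complex.Re z ^+ 2 + complex.Im z ^+ 2).

Definition contC (f : X -> C) : Prop := continuous f.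
Definition supnorm (f : X -> C) : R := sup [set cabs (f x) | x in [set: X]].

Definition sigpow (k : int) : X -> X :=
  match k with
  | Posz n => iter n sigma
  | Negz n => iter n.+1 sigmainv
  end.

Definition alphapow (k : int) (f : X -> C) : X -> C := f \o sigpow (- k).

Definition Lelt := int -> X -> C.

(* sum over Z of complex numbers, as the limit of the partial sums
   over -N <= k < N (all sums used below are absolutely convergent) *)
Definition zsum (u : int -> C) : C :=
  lim ((fun N : nat => \sum_(0 <= n < N) (u (Posz n) + u (Negz n))) @ \oo).

Definition is_l1 (l : Lelt) : Prop :=
  (forall k, contC (l k)) /\
  cvg ((fun N : nat =>
          \sum_(0 <= n < N) (supnorm (l (Posz n)) + supnorm (l (Negz n)))) @ \oo).

Definition Ladd (a b : Lelt) : Lelt := fun k x => a k x + b k x.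
Definition Lscale (c : C) (a : Lelt) : Lelt := fun k x => c * a k x.
Definition Lopp (a : Lelt) : Lelt := fun k x => - a k x.
Definition Lsub (a b : Lelt) : Lelt := Ladd a (Lopp b).
Definition Lmul (a b : Lelt) : Lelt :=
  fun n x => zsum (fun k => a k x * alphapow k (b (n - k)) x).
Definition Lstar (a : Lelt) : Lelt :=
  fun n x => (alphapow n (a (- n)) x)^*.
Definition Lemb (f : X -> C) : Lelt := fun k => if k == 0 then f else (fun _ => 0).

Definition cstar_seminorm (S : set Lelt) (p : Lelt -> R) : Prop :=
  [/\ forall a, S a -> 0 <= p a,
      forall a b, S a -> S b -> p (Ladd a b) <= p a + p b,
      forall c a, S a -> p (Lscale c a) = cabs c * p a,
      forall a b, S a -> S b -> p (Lmul a b) <= p a * p b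
    & forall a, S a -> p (Lmul (Lstar a) a) = p a ^+ 2].

Definition envnorm (S : set Lelt) (a : Lelt) : R :=
  sup [set p a | p in cstar_seminorm S].

Definition L1 : set Lelt := [set l | is_l1 l].

Definition commutant1 : set Lelt :=
  [set a | L1 a /\ forall f, contC f -> Lmul a (Lemb f) = Lmul (Lemb f) a].

(* norm of C*(Sigma) restricted to l^1(Sigma) *)
Definition cstarnorm (a : Lelt) : R := envnorm L1 a.

End Crossed.

(* Main.v *)
Require Import Defs.
From HB Require Import structures.
From mathcomp Require Import all_boot all_order all_algebra.
From mathcomp Require Import all_classical all_reals all_analysis.
From mathcomp Require Import complex.
From mathcomp Require Import ring lra zify.
Import Order.TTheory GRing.Theory Num.Theory.
Import numFieldTopology.Exports numFieldNormedType.Exports.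
Set Implicit Arguments.
Unset Strict Implicit.
Unset Printing Implicit Defensive.
Local Open Scope classical_set_scope.
Local Open Scope ring_scope.

(* A C*-seminorm on a closed unital *-subalgebra of l^1(Sigma) is dominated by the l^1-norm:
   if h = h^* has norm < 1 and s is the square root of 1 - h^2, then h is the real part of the
   unitary h + i s. Let q be the norm of the regular representations on l^2(Z) along the orbits.
   It dominates every coefficient a(n)(x), so for self-adjoint h supported in [-d, d[ and a
   C*-seminorm p one has p(h)^n = p(h^n) <= |h^n|_1 <= 2 d n q(h)^n for n = 2^m, whence p <= q
   on h, and on the whole subalgebra by truncation. Thus q is the enveloping C*-norm both of
   l^1(Sigma) and of the commutant of C(X) in it.
   For the density, the Fourier coefficients of an element of C*(Sigma) commuting with C(X)
   satisfy the equations that define the commutant in l^1(Sigma), hence so do its Fejer means;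
   these converge to the element because Fejer summation is a Schur multiplier of norm <= 1. *)

(** A C*-seminorm on the commutant is not known beforehand to extend to [L1], so everything about it
    has to be proved inside the subalgebra. This is why the square root is built by a contraction
    that stays in [S], and why the comparison is stated for any [good_subalgebra]. A seminorm is not
    assumed continuous either; domination by the l^1-norm supplies the continuity that truncation
    needs. The comparison with q rests on the linear growth of Z: a power h^n has at most 2 d n
    coefficients, each bounded by q(h^n), and this factor disappears under n-th roots. Only n = 2^m
    occurs because the C*-identity for a self-adjoint element speaks of squares. Neither a Hilbert
    space nor a completion is built: q is read off from finite sections of the orbit matrices, and a
    Cauchy sequence in l^1(Sigma) stands for an element of C*(Sigma). The Fourier coefficients of
    such an element need not be summable, and plain truncations of them are in general not uniformly
    bounded in the C*-norm; this is what makes Fejer means necessary. *)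

Section Modulus.
Variable R : realType.
Local Notation C := (Cplx R).
Implicit Types (z w : C).

(** The norm of [C] takes its values in [C], whereas [cabs] is real; [cofr] carries the general
    facts about the norm over to [cabs]. *)
Definition cofr (r : R) : C := (r +i* 0)%C.

Lemma normE z : `|z| = cofr (cabs z).
Proof. by rewrite /cabs /cofr; case: z. Qed.

Lemma cofr_inj : injective cofr.
Proof. by move=> x y []. Qed.

Lemma cofrD x y : cofr (x + y) = cofr x + cofr y.
Proof. by apply/eqP; rewrite eq_complex /= addr0 !eqxx. Qed.

Lemma cofrM x y : cofr (x * y) = cofr x * cofr y.
Proof. by apply/eqP; rewrite eq_complex /= !mulr0 !mul0r subr0 addr0 !eqxx. Qed.

Lemma cofr_le x y : (cofr x <= cofr y) = (x <= y).
Proof. by rewrite lecE /= eqxx. Qed.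

Lemma cofr_lt x y : (cofr x < cofr y) = (x < y).
Proof. by rewrite ltcE /= eqxx. Qed.

Lemma cofr_conj x : (cofr x)^* = cofr x.
Proof. by apply/CrealP; rewrite complex_real. Qed.

Lemma cabs_ge0 z : 0 <= cabs z.
Proof. exact: sqrtr_ge0. Qed.

Lemma cabsM z w : cabs (z * w) = cabs z * cabs w.
Proof. by apply: cofr_inj; rewrite cofrM -!normE normrM. Qed.

Lemma cabsD z w : cabs (z + w) <= cabs z + cabs w.
Proof. by rewrite -cofr_le cofrD -!normE ler_normD. Qed.

Lemma cabsN z : cabs (- z) = cabs z.
Proof. by apply: cofr_inj; rewrite -!normE normrN. Qed.

Lemma cabsB z w : cabs (z - w) = cabs (w - z).
Proof. by rewrite -cabsN opprB. Qed.

Lemma cabsJ z : cabs z^* = cabs z.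
Proof. by apply: cofr_inj; rewrite -!normE norm_conjC. Qed.

Lemma cabs_cofr (r : R) : 0 <= r -> cabs (cofr r) = r.
Proof. by move=> r0; apply: cofr_inj; rewrite -normE ger0_norm // -[0]/(cofr 0) cofr_le. Qed.

Lemma cabs0 : cabs (0 : C) = 0.
Proof. exact: (@cabs_cofr 0). Qed.

Lemma cabs1 : cabs (1 : C) = 1.
Proof. exact: (@cabs_cofr 1). Qed.

Lemma cabs_eq0 z : cabs z = 0 -> z = 0.
Proof. by move=> z0; apply/normr0_eq0; rewrite normE z0. Qed.

Lemma mul_conj z : z^* * z = cofr (cabs z ^+ 2).
Proof. by rewrite expr2 cofrM -normE mulrC -normCK expr2. Qed.

Lemma cabs_sum (I : Type) (r : seq I) (F : I -> C) :
  cabs (\sum_(i <- r) F i) <= \sum_(i <- r) cabs (F i).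
Proof.
elim: r => [|i r IH]; first by rewrite !big_nil cabs0.
by rewrite !big_cons (le_trans (cabsD _ _)) // lerD2l.
Qed.

Lemma cabs_dist_abs z w : `|cabs z - cabs w| <= cabs (z - w).
Proof.
rewrite ler_norml; apply/andP; split.
  by rewrite lerNl opprB lerBlDr cabsB (le_trans _ (cabsD _ _)) // subrK.
by rewrite lerBlDr (le_trans _ (cabsD _ _)) // subrK.
Qed.

Lemma cvg_cabsP (T : Type) (F : set_system T) (FF : Filter F) (u : T -> C) (l : C) :
  u @ F --> l <-> forall e : R, 0 < e -> \forall t \near F, cabs (u t - l) < e.
Proof.
split=> [/cvgrPdist_lt H e e0|H].
  have /H : (0 : C) < cofr e by rewrite -[0]/(cofr 0) cofr_lt.
  by apply: filterS => t; rewrite normE cofr_lt cabsB.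
apply/cvgrPdist_lt => e; rewrite ltcE => /andP[/= /eqP Ie Re].
apply: filterS (H _ Re) => t; rewrite normE cabsB -cofr_lt.
by congr (_ < _); case: e Ie {Re} => a b /= ->.
Qed.

Lemma cvg_cabs (T : Type) (F : set_system T) (FF : Filter F) (u : T -> C) (l : C) :
  u @ F --> l -> (fun t => cabs (u t)) @ F --> cabs l.
Proof.
move=> /cvg_cabsP H; apply/cvgrPdist_lt => e e0.
by apply: filterS (H _ e0) => t; apply: le_lt_trans; rewrite distrC cabs_dist_abs.
Qed.

Lemma cabs_ge_Re z : `|complex.Re z| <= cabs z.
Proof. by rewrite -cofr_le -normE; exact: (@normc_ge_Re R z). Qed.

Lemma cabs_ge_Im z : `|complex.Im z| <= cabs z.
Proof.
by rewrite /cabs -sqrtr_sqr; apply: ler_wsqrtr; rewrite lerDr sqr_ge0.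
Qed.

Lemma cabs_le_ReIm z : cabs z <= `|complex.Re z| + `|complex.Im z|.
Proof.
have h0 : 0 <= `|complex.Re z| + `|complex.Im z| by rewrite addr_ge0.
rewrite -[leRHS](ger0_norm h0) -(sqrtr_sqr (_ + _)); apply: ler_wsqrtr.
rewrite -(real_normK (num_real (complex.Re z))) -(real_normK (num_real (complex.Im z))).
by rewrite sqrrD -addrA lerD2l lerDr mulrn_wge0 ?mulr_ge0.
Qed.

Lemma real_cauchy_cvg (u : nat -> R) :
  (forall e, 0 < e -> exists N : nat, forall m n, (N <= m)%N -> (N <= n)%N ->
     `|u m - u n| < e) -> cvg (u @ \oo).
Proof.
move=> H; apply/cauchy_cvgP.
apply/cauchy_exP => e e0; have [N HN] := H _ e0.
by exists (u N); exists N => // n /= Nn; rewrite /ball /=; apply: HN.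
Qed.

Lemma cplx_cauchy_cvg (u : nat -> C) :
  (forall e : R, 0 < e -> exists N : nat, forall m n, (N <= m)%N -> (N <= n)%N ->
     cabs (u m - u n) < e) -> exists l : C, u @ \oo --> l.
Proof.
move=> H.
have HRe : cvg ((fun n => complex.Re (u n)) @ \oo).
  apply: real_cauchy_cvg => e e0; have [N HN] := H _ e0; exists N => m n Nm Nn.
  apply: le_lt_trans (HN m n Nm Nn); apply: le_trans (cabs_ge_Re _).
  by case: (u m) (u n) => [a b] [c d].
have HIm : cvg ((fun n => complex.Im (u n)) @ \oo).
  apply: real_cauchy_cvg => e e0; have [N HN] := H _ e0; exists N => m n Nm Nn.
  apply: le_lt_trans (HN m n Nm Nn); apply: le_trans (cabs_ge_Im _).
  by case: (u m) (u n) => [a b] [c d].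
exists (lim ((fun n => complex.Re (u n)) @ \oo) +i* lim ((fun n => complex.Im (u n)) @ \oo))%C.
apply/cvg_cabsP => e e0.
have e2 : 0 < e / 2 by rewrite divr_gt0.
move/cvgrPdist_lt/(_ _ e2) : HRe; move/cvgrPdist_lt/(_ _ e2) : HIm.
apply: filterS2 => n hI hR; apply: le_lt_trans (cabs_le_ReIm _) _.
rewrite [e]splitr; case: (u n) hI hR => a b /= hI hR.
by rewrite ltrD // distrC.
Qed.

End Modulus.

(** * The exhaustion of the integers by the intervals [-N, N[ *)

Section IntRange.

Fixpoint rng (N : nat) : seq int :=
  if N is n.+1 then [:: Posz n, Negz n & rng n] else [::].

Lemma mem_rng k N : (k \in rng N) = (match k with Posz n | Negz n => n < N end)%N.
Proof.
elim: N => [|N IH] /=; first by case: k.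
by rewrite !inE IH; case: k {IH} => n; lia.
Qed.

Lemma rng_uniq N : uniq (rng N).
Proof. by elim: N => [//|N IH] /=; rewrite !inE !mem_rng !ltnn IH. Qed.

Lemma rng_sub m n : (m <= n)%N -> {subset rng m <= rng n}.
Proof. by move=> mn [k|k]; rewrite !mem_rng => /leq_trans; apply. Qed.

Lemma sub_rng (r : seq int) : exists N, {subset r <= rng N}.
Proof.
elim: r => [|k r [N HN]]; first by exists 0%N.
exists (maxn N (match k with Posz n | Negz n => n.+1 end)) => j; rewrite inE => /orP[/eqP ->|/HN].
  by rewrite mem_rng; case: k => k; rewrite leq_maxr.
by apply: rng_sub; rewrite leq_maxl.
Qed.

Lemma size_rng N : size (rng N) = N.*2.
Proof. by elim: N => //= N ->. Qed.

Lemma sum_rng (V : nmodType) (u : int -> V) N :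
  \sum_(0 <= n < N) (u (Posz n) + u (Negz n)) = \sum_(k <- rng N) u k.
Proof.
elim: N => [|N IH]; first by rewrite big_geq // big_nil.
by rewrite big_nat_recr //= IH !big_cons [RHS]addrA addrC.
Qed.

Lemma sum_sub_split (V : zmodType) (u : int -> V) (r s : seq int) :
  uniq r -> uniq s -> {subset r <= s} ->
  \sum_(k <- s) u k = \sum_(k <- r) u k + \sum_(k <- s | k \notin r) u k.
Proof.
move=> ur us rs; rewrite (bigID (mem r)) /=; congr (_ + _).
rewrite -big_filter; apply: perm_big; apply: uniq_perm => //; first exact: filter_uniq.
by move=> k; rewrite mem_filter; case: (boolP (k \in r)) => // /rs ->.
Qed.

Lemma sum_rng_shift1 (V : zmodType) (u : int -> V) N :
  \sum_(k <- rng N) u (k + 1) = \sum_(k <- rng N) u k + u N%:Z - u (- N%:Z).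
Proof.
elim: N => [|N IH]; first by rewrite !big_nil oppr0 add0r subrr.
rewrite !big_cons IH.
have -> : Posz N + 1 = N.+1%:Z by lia.
have -> : Negz N + 1 = - N%:Z by lia.
have -> : - N.+1%:Z = Negz N by lia.
set S := \sum_(_ <- _) _; set a := u N%:Z; set b := u (- _); set c := u N.+1%:Z; set d := u _.
by rewrite [b + _]addrC subrK [RHS]addrAC (addrCA a d) [d + _]addrC addrK addrC [S + a]addrC.
Qed.

(** The interval [-N, N[ is not symmetric: reflection maps it to ]-N, N], its translate by 1. *)
Lemma sum_rng_opp (V : zmodType) (u : int -> V) N :
  \sum_(k <- rng N) u (- k) = \sum_(k <- rng N) u (k + 1).
Proof.
elim: N => [|N IH]; first by rewrite !big_nil.
rewrite !big_cons IH addrCA; do 2?congr (_ + _); congr u; lia.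
Qed.

End IntRange.

(** * Unconditional sums of nonnegative families *)

Section NonnegSums.
Variable R : realType.
Implicit Types (w : int -> R) (W : R).

(** Summability as a bound on all finite partial sums: in this form it passes to dominated and
    injectively reindexed families without any limit. *)
Definition zbound w W := forall r, uniq r -> \sum_(k <- r) w k <= W.
Definition ztot w := sup [set \sum_(k <- r) w k | r in [set r : seq int | uniq r]].

Lemma ler_sum_sub w (r s : seq int) : (forall k, 0 <= w k) ->
  uniq r -> uniq s -> {subset r <= s} -> \sum_(k <- r) w k <= \sum_(k <- s) w k.
Proof.
by move=> w0 ur us rs; rewrite (sum_sub_split w ur us rs) lerDl sumr_ge0.
Qed.

Lemma zbound_rng w W : (forall k, 0 <= w k) ->
  (forall N, \sum_(k <- rng N) w k <= W) -> zbound w W.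
Proof.
move=> w0 H r ur; have [N rN] := sub_rng r.
by apply: le_trans (H N); apply: ler_sum_sub => //; exact: rng_uniq.
Qed.

Lemma zbound_term w W k : zbound w W -> w k <= W.
Proof. by move=> /(_ [:: k] erefl); rewrite big_seq1. Qed.

Lemma zbound_ge0 w W : zbound w W -> 0 <= W.
Proof. by move=> /(_ [::] erefl); rewrite big_nil. Qed.

Lemma zbound_le w w' W : (forall k, w k <= w' k) -> zbound w' W -> zbound w W.
Proof. by move=> ww H r ur; apply: le_trans (H r ur); apply: ler_sum. Qed.

Lemma zboundD w w' W W' : zbound w W -> zbound w' W' -> zbound (fun k => w k + w' k) (W + W').
Proof. by move=> H H' r ur; rewrite big_split /= lerD ?H ?H'. Qed.

Lemma zboundZ c w W : 0 <= c -> zbound w W -> zbound (fun k => c * w k) (c * W).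
Proof. by move=> c0 H r ur; rewrite -mulr_sumr ler_wpM2l ?H. Qed.

Lemma zbound_inj w W (f : int -> int) : injective f -> zbound w W -> zbound (w \o f) W.
Proof.
by move=> fi H r ur; rewrite -(big_map f xpredT w) H // map_inj_uniq.
Qed.

Lemma zbound_ztot w W : zbound w W -> zbound w (ztot w).
Proof.
move=> H r ur; apply: ub_le_sup; last by exists r.
by exists W => _ [s us <-]; exact: H.
Qed.

Lemma ztot_le w W : zbound w W -> ztot w <= W.
Proof.
move=> H; apply: ge_sup; last by move=> _ [s us <-]; exact: H.
by exists 0, [::] => //; rewrite big_nil.
Qed.

Lemma ztot_ge w W e : zbound w W -> 0 < e ->
  exists2 r, uniq r & ztot w - e < \sum_(k <- r) w k.
Proof.
move=> H e0.
have hs : has_sup [set \sum_(k <- r) w k | r in [set r : seq int | uniq r]].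
  split; first by exists 0, [::] => //; rewrite big_nil.
  by exists W => _ [s us <-]; exact: H.
by have [_ [r ur <-] hr] := sup_adherent e0 hs; exists r.
Qed.

(** A finite list whose sum is within [e] of the supremum leaves less than [e] to every disjoint
    list. The tail is the family set to 0 on [rng N], so that the lemmas on [zbound] apply to it. *)
Lemma zbound_tail w W e : (forall k, 0 <= w k) -> zbound w W -> 0 < e ->
  exists N, zbound (fun k => if k \in rng N then 0 else w k) e.
Proof.
move=> w0 H e0; have [r ur hr] := ztot_ge H e0; have [N rN] := sub_rng r.
exists N => s us; have Ht := zbound_ztot H.
rewrite (eq_bigr (fun k => if k \notin rng N then w k else 0)); last by move=> k _; case: ifP.
rewrite -big_mkcond /= -big_filter.
have u2 : uniq (rng N ++ [seq k <- s | k \notin rng N]).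
  rewrite cat_uniq rng_uniq filter_uniq // andbT /=; apply/hasPn => k.
  by rewrite mem_filter => /andP[].
have := Ht _ u2; rewrite big_cat /=.
have : \sum_(k <- r) w k <= \sum_(k <- rng N) w k by apply: ler_sum_sub => //; exact: rng_uniq.
lra.
Qed.

End NonnegSums.

(** * Absolutely convergent complex series over the integers *)

Section ZSum.
Variable R : realType.
Local Notation C := (Cplx R).
Implicit Types (u v : int -> C) (W : R).

Local Notation zb u := (zbound (fun k => cabs (u k))).

Lemma zsumE u : zsum u = lim ((fun N => \sum_(k <- rng N) u k) @ \oo).
Proof. by rewrite /zsum; under [in LHS]eq_fun do rewrite sum_rng. Qed.

Lemma zsum_lim u (l : C) : (fun N => \sum_(k <- rng N) u k) @ \oo --> l -> zsum u = l.
Proof. by move=> H; rewrite zsumE; apply: cvg_lim => //; exact: norm_hausdorff. Qed.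

Lemma sum_tail_le u W N r : uniq r -> {subset rng N <= r} ->
  zbound (fun k => if k \in rng N then 0 else cabs (u k)) W ->
  cabs (\sum_(k <- r) u k - \sum_(k <- rng N) u k) <= W.
Proof.
move=> ur Nr H; rewrite (sum_sub_split u (rng_uniq N) ur Nr) addrC addKr.
rewrite -big_filter; apply: le_trans (cabs_sum _ _) _; rewrite big_filter.
apply: le_trans (H r ur); rewrite big_mkcond /=; apply: ler_sum => k _.
by case: (k \in rng N).
Qed.

Lemma cvg_zsum u W : zb u W -> (fun N => \sum_(k <- rng N) u k) @ \oo --> zsum u.
Proof.
move=> H; suff [l Hl] : exists l : C, (fun N => \sum_(k <- rng N) u k) @ \oo --> l.
  by rewrite (zsum_lim Hl).
apply: cplx_cauchy_cvg => e e0.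
have e3 : 0 < e / 3 by rewrite divr_gt0.
have [N HN] := zbound_tail (fun k => cabs_ge0 (u k)) H e3.
exists N => m n Nm Nn.
have Hm := sum_tail_le (rng_uniq m) (rng_sub Nm) HN.
have Hn := sum_tail_le (rng_uniq n) (rng_sub Nn) HN.
set a := \sum_(_ <- _) _ in Hm *; set b := \sum_(_ <- rng n) _ in Hn *.
set c := \sum_(_ <- rng N) _ in Hm Hn *.
have -> : a - b = (a - c) + (c - b) by ring.
by apply: le_lt_trans (cabsD _ _) _; rewrite (cabsB c b); lra.
Qed.

Lemma cabs_cvg_le (v : nat -> C) (l : C) W :
  v @ \oo --> l -> (forall n, cabs (v n) <= W) -> cabs l <= W.
Proof.
move=> /cvg_cabs H Hv; rewrite -(cvg_lim _ H) //; apply: limr_le; first exact: cvgP H.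
by near=> n; exact: Hv.
Unshelve. all: by end_near. Qed.

Lemma zsum_tail u W V N : zb u V ->
  zbound (fun k => if k \in rng N then 0 else cabs (u k)) W ->
  cabs (zsum u - \sum_(k <- rng N) u k) <= W.
Proof.
move=> HV H; set c := \sum_(k <- _) _.
have Hc : (fun M => \sum_(k <- rng (N + M)) u k - c) @ \oo --> zsum u - c.
  apply: cvgB; last exact: cvg_cst.
  by have := cvg_zsum HV; rewrite -(cvg_shiftn N); under eq_fun do rewrite addnC.
apply: cabs_cvg_le Hc _ => M.
by apply: sum_tail_le => //; [exact: rng_uniq | apply: rng_sub; rewrite leq_addr].
Qed.

Lemma zsum_fin u r : uniq r -> (forall k, k \notin r -> u k = 0) ->
  zsum u = \sum_(k <- r) u k.
Proof.
move=> ur H; have [N rN] := sub_rng r; apply: zsum_lim.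
apply/cvg_cabsP => e e0; exists N => //= n /= Nn.
rewrite (sum_sub_split u ur (rng_uniq n)); last by move=> k /rN; exact: rng_sub.
by rewrite addrC addKr big1 // cabs0.
Qed.

Lemma zsum1 u j : (forall k, k != j -> u k = 0) -> zsum u = u j.
Proof.
move=> H; rewrite (zsum_fin (r := [:: j])) ?big_seq1 // => k.
by rewrite inE => /H.
Qed.

Lemma zsumD u v W V : zb u W -> zb v V -> zsum (fun k => u k + v k) = zsum u + zsum v.
Proof.
move=> Hu Hv; apply: zsum_lim; under eq_fun do rewrite big_split /=.
by apply: cvgD; [exact: cvg_zsum Hu | exact: cvg_zsum Hv].
Qed.

Lemma zsumZ u W (c : C) : zb u W -> zsum (fun k => c * u k) = c * zsum u.
Proof.
move=> Hu; apply: zsum_lim; under eq_fun do rewrite -mulr_sumr.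
by apply: cvgM; [exact: cvg_cst | exact: cvg_zsum Hu].
Qed.

Lemma zsum_conj u W : zb u W -> zsum (fun k => (u k)^*) = (zsum u)^*.
Proof.
move=> Hu; apply: zsum_lim; under eq_fun do rewrite -rmorph_sum /=.
move/cvg_cabsP: (cvg_zsum Hu) => H; apply/cvg_cabsP => e e0.
by apply: filterS (H e e0) => N; rewrite -rmorphB cabsJ.
Qed.

Lemma zterm_cvg u W (f : nat -> int) : zb u W -> injective f ->
  (fun N => u (f N)) @ \oo --> (0 : C).
Proof.
move=> H fi; apply/cvg_cabsP => e e0.
have e2 : 0 < e / 2 by rewrite divr_gt0.
have [N HN] := zbound_tail (fun k => cabs_ge0 (u k)) H e2.
(* An injective sequence visits each index at most once, so it eventually leaves every finite
   set. *)
have [M HM] : exists M, forall n, (M <= n)%N -> f n \notin rng N.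
  elim: (rng N) => [|k r [M HM]]; first by exists 0%N.
  have [[j fj]|nj] := pselect (exists j, f j = k).
    exists (maxn M j.+1) => n; rewrite geq_max => /andP[Mn jn].
    rewrite inE negb_or HM // andbT -fj; apply/eqP => /fi nj; move: jn.
    by rewrite nj ltnn.
  exists M => n Mn; rewrite inE negb_or HM // andbT; apply/eqP => fk.
  by apply: nj; exists n.
exists M => // n /= /HM; rewrite subr0.
by move=> nr; have := zbound_term (f n) HN; rewrite (negbTE nr); lra.
Qed.

(** Translating the interval of summation by 1 changes only two boundary terms, and these tend to
    0. *)
Lemma zsum_shift1 u W : zb u W -> zsum (fun k => u (k + 1)) = zsum u.
Proof.
move=> H; apply: zsum_lim; under eq_fun do rewrite sum_rng_shift1.
have -> : zsum u = zsum u + 0 - 0 by rewrite addr0 subr0.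
apply: cvgB; last first.
  by apply: zterm_cvg H _ => i j /oppr_inj [].
by apply: cvgD; [exact: cvg_zsum H | apply: zterm_cvg H _ => i j []].
Qed.

Lemma zsum_opp u W : zb u W -> zsum (fun k => u (- k)) = zsum u.
Proof.
move=> H; rewrite -(zsum_shift1 H) !zsumE.
by congr (lim (_ @ \oo)); apply/funext => N; rewrite sum_rng_opp.
Qed.

Lemma zsum_shift u W d : zb u W -> zsum (fun k => u (k + d)) = zsum u.
Proof.
move=> H; elim/int_rect: d => [|n IH|n IH].
- by congr zsum; apply/funext => k; rewrite addr0.
- rewrite -IH -(zsum_shift1 (u := fun k => u (k + n%:Z)) (W := W)); last first.
    by apply: zbound_inj H => i j /addIr.
  by congr zsum; apply/funext => k; congr u; lia.
- rewrite -IH -(zsum_shift1 (u := fun k => u (k - n.+1%:Z)) (W := W)); last first.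
    by apply: zbound_inj H => i j /addIr.
  by congr zsum; apply/funext => k; congr u; lia.
Qed.

Lemma zsum_reflect u W d : zb u W -> zsum (fun k => u (d - k)) = zsum u.
Proof.
move=> H; rewrite -(zsum_opp H).
rewrite -(@zsum_shift (fun k => u (- k)) W (- d)); last first.
  by apply: zbound_inj H => i j /oppr_inj.
by congr zsum; apply/funext => k; congr u; lia.
Qed.

End ZSum.

(** * Continuous functions and the supremum norm on a compact space *)

Section Continuity.
Variables (R : realType) (X : topologicalType).
Local Notation C := (Cplx R).
Implicit Types f g : X -> C.

Lemma contCP f : contC f <->
  forall x (e : R), 0 < e -> \forall t \near x, cabs (f t - f x) < e.
Proof. by split=> H x; [exact/cvg_cabsP/H | exact/cvg_cabsP/(H x)]. Qed.

Lemma contC_cst (c : C) : contC (fun _ : X => c).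
Proof. exact: cst_continuous. Qed.

Lemma contCD f g : contC f -> contC g -> contC (fun x => f x + g x).
Proof. by move=> hf hg x; apply: cvgD; [exact: hf | exact: hg]. Qed.

Lemma contCM f g : contC f -> contC g -> contC (fun x => f x * g x).
Proof. by move=> hf hg x; apply: cvgM; [exact: hf | exact: hg]. Qed.

Lemma contCB f g : contC f -> contC g -> contC (fun x => f x - g x).
Proof. by move=> hf hg x; apply: cvgB; [exact: hf | exact: hg]. Qed.

Lemma contCJ f : contC f -> contC (fun x => (f x)^*).
Proof.
move=> /contCP hf; apply/contCP => x e e0.
by apply: filterS (hf x e e0) => t; rewrite -rmorphB cabsJ.
Qed.

Lemma contC_comp f (s : X -> X) : contC f -> continuous s -> contC (f \o s).
Proof. by move=> hf hs x; apply: continuous_comp; [exact: hs | exact: hf]. Qed.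

Lemma contC_sum (I : Type) (r : seq I) (F : I -> X -> C) :
  (forall i, contC (F i)) -> contC (fun x => \sum_(i <- r) F i x).
Proof.
move=> hF; elim: r => [|i r IH].
  by under eq_fun do rewrite big_nil; exact: contC_cst.
rewrite (_ : (fun x => _) = (fun x => F i x + \sum_(j <- r) F j x)).
  exact: (contCD (hF i) IH).
by apply/funext => x; rewrite big_cons.
Qed.

Lemma contC_unif g :
  (forall e : R, 0 < e -> exists2 f, contC f & forall x, cabs (f x - g x) <= e) -> contC g.
Proof.
move=> H; apply/contCP => x e e0.
have e4 : 0 < e / 4 by rewrite divr_gt0.
have [f /contCP hf fg] := H _ e4.
apply: filterS (hf x _ e4) => t ht.
have -> : g t - g x = (f t - f x) - (f t - g t) + (f x - g x) by ring.
have := fg t; have := fg x.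
have := cabsD ((f t - f x) - (f t - g t)) (f x - g x).
have := cabsD (f t - f x) (- (f t - g t)); rewrite cabsN; lra.
Qed.

Hypothesis Xcpt : compact [set: X].
Hypothesis Xne : [set: X] !=set0.

Lemma supnorm_attained f : contC f ->
  exists x, supnorm f = cabs (f x) /\ forall y, cabs (f y) <= cabs (f x).
Proof.
move=> hf.
have hc : {within [set: X], continuous (fun x => cabs (f x))}.
  by apply: continuous_subspaceT => x; apply: cvg_cabs; exact: hf.
have [x _ hx] := compact_EVT_max Xne Xcpt hc.
have hx' y : cabs (f y) <= cabs (f x) by apply: hx; rewrite inE.
exists x; split=> //; apply/eqP; rewrite eq_le; apply/andP; split.
  by apply: ge_sup; [exists (cabs (f x)), x | move=> _ [y _ <-]].
by apply: ub_le_sup; [exists (cabs (f x)) => _ [y _ <-] | exists x].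
Qed.

Lemma supnorm_ge f x : contC f -> cabs (f x) <= supnorm f.
Proof. by move=> /supnorm_attained[y [-> ]]; exact. Qed.

Lemma supnorm_le f (M : R) : (forall x, cabs (f x) <= M) -> supnorm f <= M.
Proof.
move=> H; case: Xne => x _.
by apply: ge_sup; [exists (cabs (f x)), x | move=> _ [y _ <-]].
Qed.

Lemma supnorm_ge0 f : contC f -> 0 <= supnorm f.
Proof. by move=> /supnorm_attained[x [-> _]]; exact: cabs_ge0. Qed.

End Continuity.
Arguments contC_cst {R X} c.

(** * Iterates of the homeomorphism *)

Section Orbit.
Variables (X : topologicalType) (sigma sigmainv : X -> X).
Hypothesis sigma_cont : continuous sigma.
Hypothesis sigmainv_cont : continuous sigmainv.
Hypothesis sigmaK : cancel sigma sigmainv.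
Hypothesis sigmainvK : cancel sigmainv sigma.
Local Notation sp := (sigpow sigma sigmainv).

Lemma sigpow_cont k : continuous (sp k).
Proof.
have H (s : X -> X) n : continuous s -> continuous (iter n s).
  by move=> hs; elim: n => [|n IH] x //=; apply: continuous_comp; [exact: IH | exact: hs].
by case: k => n; exact: H.
Qed.

Lemma sigpow_succ k x : sp (k + 1) x = sigma (sp k x).
Proof.
case: k => [n|[|n]]; first by rewrite -PoszD addn1.
  by rewrite /= sigmainvK.
have -> : Negz n.+1 + 1 = Negz n by lia.
by rewrite /= sigmainvK.
Qed.

Lemma sigpow_pred k x : sp (k - 1) x = sigmainv (sp k x).
Proof. by rewrite -[in RHS](subrK 1 k) sigpow_succ sigmaK. Qed.

Lemma sigpowD j k x : sp (j + k) x = sp j (sp k x).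
Proof.
elim/int_rect: j => [|n IH|n IH]; first by rewrite add0r.
  by rewrite (_ : n.+1%:Z + k = n%:Z + k + 1) ?sigpow_succ ?IH //; lia.
rewrite (_ : - n.+1%:Z + k = - n%:Z + k - 1); last lia.
rewrite sigpow_pred IH (_ : - n.+1%:Z = - n%:Z - 1); last lia.
by rewrite sigpow_pred.
Qed.

Lemma sigpowK k x : sp k (sp (- k) x) = x.
Proof. by rewrite -sigpowD subrr. Qed.

End Orbit.

(* Both definitions stop a failing conversion test from unfolding the limits and suprema. *)
Variant l1elt (R : realType) (X : topologicalType) (a : Lelt R X) : Prop := L1elt of L1 a.

HB.lock Definition N1 (R : realType) (X : topologicalType) (a : Lelt R X) : R :=
  ztot (fun k => supnorm (a k)).

Lemma N1E (R : realType) (X : topologicalType) (a : Lelt R X) :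
  N1 a = ztot (fun k => supnorm (a k)).
Proof. by rewrite N1.unlock. Qed.

(** * The Banach *-algebra l^1(Sigma) *)

Section L1Algebra.
Variables (R : realType) (X : topologicalType) (sigma sigmainv : X -> X).
Hypotheses (Xne : [set: X] !=set0) (Xcpt : compact [set: X]).
Hypotheses (sigma_cont : continuous sigma) (sigmainv_cont : continuous sigmainv).
Hypotheses (sigmaK : cancel sigma sigmainv) (sigmainvK : cancel sigmainv sigma).
Local Notation C := (Cplx R).
Local Notation sp := (sigpow sigma sigmainv).
Local Notation mul := (@Lmul R X sigma sigmainv).
Local Notation star := (@Lstar R X sigma sigmainv).
Implicit Types a b c : Lelt R X.

Lemma L1_intro a W : (forall k, contC (a k)) -> zbound (fun k => supnorm (a k)) W -> l1elt a.
Proof.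
move=> ha H; split; split=> //; apply: nondecreasing_is_cvgn.
  apply/nondecreasing_seqP => n; rewrite big_nat_recr //= lerDl.
  by rewrite addr_ge0 // supnorm_ge0.
by exists W => _ [n _ <-]; rewrite (sum_rng (fun k => supnorm (a k))) H ?rng_uniq.
Qed.

Lemma L1_cont a : l1elt a -> forall k, contC (a k).
Proof. by case; case. Qed.
Arguments L1_cont {a} _ k.

Lemma L1_bound a : l1elt a -> zbound (fun k => supnorm (a k)) (N1 a).
Proof.
move=> [[ha hc]]; rewrite N1E.
apply: (@zbound_ztot _ _ (lim ((fun N : nat =>
          \sum_(0 <= n < N) (supnorm (a (Posz n)) + supnorm (a (Negz n)))) @ \oo))).
apply: zbound_rng => [k|N]; first exact: supnorm_ge0.
rewrite -(sum_rng (fun k => supnorm (a k))).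
apply: (nondecreasing_cvgn_le _ hc N).
by apply/nondecreasing_seqP => n; rewrite big_nat_recr //= lerDl addr_ge0 // supnorm_ge0.
Qed.

Lemma N1_le a W : zbound (fun k => supnorm (a k)) W -> N1 a <= W.
Proof. by rewrite N1E; exact: ztot_le. Qed.

Lemma N1_ge0 a : l1elt a -> 0 <= N1 a.
Proof. by move=> /L1_bound/zbound_ge0. Qed.

Lemma supnorm_N1 a k : l1elt a -> supnorm (a k) <= N1 a.
Proof. by move=> /L1_bound/(zbound_term k). Qed.

Lemma cabs_supnorm a k x : l1elt a -> cabs (a k x) <= supnorm (a k).
Proof. by move=> ha; exact: (supnorm_ge Xcpt Xne x (L1_cont ha k)). Qed.

Lemma cabs_N1 a k x : l1elt a -> cabs (a k x) <= N1 a.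
Proof. by move=> ha; exact: le_trans (cabs_supnorm k x ha) (supnorm_N1 k ha). Qed.

(* The supremum norms are attained, so finitely many of them are evaluations at points. *)
Lemma zbound_supnorm a W : (forall k, contC (a k)) ->
  (forall (x : int -> X) r, uniq r -> \sum_(k <- r) cabs (a k (x k)) <= W) ->
  zbound (fun k => supnorm (a k)) W.
Proof.
move=> ha H.
have [x hx] := choice (fun k => supnorm_attained Xcpt Xne (ha k)).
by move=> r ur; rewrite (eq_bigr (fun k => cabs (a k (x k)))) ?H // => k _; case: (hx k).
Qed.

Lemma Lelt_eq a b : (forall k x, a k x = b k x) -> a = b.
Proof. by move=> H; apply/funext => k; apply/funext => x. Qed.

Lemma zbound_add a b : l1elt a -> l1elt b ->
  zbound (fun k => supnorm (Ladd a b k)) (N1 a + N1 b).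
Proof.
move=> ha hb; apply: zbound_le (zboundD (L1_bound ha) (L1_bound hb)) => k.
apply: supnorm_le => // x; apply: le_trans (cabsD _ _) _.
exact: lerD (cabs_supnorm k x ha) (cabs_supnorm k x hb).
Qed.

Lemma L1_add a b : l1elt a -> l1elt b -> l1elt (Ladd a b).
Proof.
move=> ha hb; apply: L1_intro (zbound_add ha hb) => k.
by apply: contCD; exact: L1_cont.
Qed.

Lemma N1_add a b : l1elt a -> l1elt b -> N1 (Ladd a b) <= N1 a + N1 b.
Proof. by move=> ha hb; apply/N1_le/zbound_add. Qed.

Lemma zbound_scale (z : C) a : l1elt a ->
  zbound (fun k => supnorm (Lscale z a k)) (cabs z * N1 a).
Proof.
move=> ha; apply: zbound_le (zboundZ (cabs_ge0 z) (L1_bound ha)) => k.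
apply: supnorm_le => // x; rewrite cabsM ler_wpM2l ?cabs_ge0 //.
exact: cabs_supnorm.
Qed.

Lemma L1_scale (z : C) a : l1elt a -> l1elt (Lscale z a).
Proof.
move=> ha; apply: L1_intro (zbound_scale z ha) => k.
by apply: contCM; [exact: contC_cst | exact: L1_cont].
Qed.

Lemma N1_scale (z : C) a : l1elt a -> N1 (Lscale z a) <= cabs z * N1 a.
Proof. by move=> ha; apply/N1_le/zbound_scale. Qed.

Lemma LoppE a : Lopp a = Lscale (-1) a.
Proof. by apply: Lelt_eq => k x; rewrite /Lscale mulN1r. Qed.

Lemma L1_opp a : l1elt a -> l1elt (Lopp a).
Proof. by rewrite LoppE; exact: L1_scale. Qed.

Lemma N1_opp a : l1elt a -> N1 (Lopp a) <= N1 a.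
Proof. by move=> ha; rewrite LoppE (le_trans (N1_scale _ ha)) // cabsN cabs1 mul1r. Qed.

Lemma L1_sub a b : l1elt a -> l1elt b -> l1elt (Lsub a b).
Proof. by move=> ha hb; exact: L1_add ha (L1_opp hb). Qed.

Lemma L1_of_sub a b : l1elt a -> l1elt (Lsub a b) -> l1elt b.
Proof.
move=> ha hab; rewrite (_ : b = Lsub a (Lsub a b)); first exact: L1_sub.
by apply: Lelt_eq => k x; rewrite /Lsub /Ladd /Lopp opprD opprK addrA subrr add0r.
Qed.

Lemma LoppB a b : Lopp (Lsub a b) = Lsub b a.
Proof. by apply: Lelt_eq => k x; rewrite /Lsub /Ladd /Lopp opprB. Qed.

Lemma N1_subC a b : l1elt a -> l1elt b -> N1 (Lsub a b) = N1 (Lsub b a).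
Proof.
have H (u v : Lelt R X) : l1elt u -> l1elt v -> N1 (Lsub u v) <= N1 (Lsub v u).
  by move=> hu hv; rewrite -(LoppB v u); exact: N1_opp (L1_sub hv hu).
by move=> ha hb; apply/eqP; rewrite eq_le (H a b ha hb) (H b a hb ha).
Qed.

Lemma N1_tri b a c : l1elt a -> l1elt b -> l1elt c -> N1 (Lsub a c) <= N1 (Lsub a b) + N1 (Lsub b c).
Proof.
move=> ha hb hc; rewrite (_ : Lsub a c = Ladd (Lsub a b) (Lsub b c)).
  exact: N1_add (L1_sub ha hb) (L1_sub hb hc).
by apply: Lelt_eq => k x; rewrite /Lsub /Ladd /Lopp addrA subrK.
Qed.

Lemma zbound_star a : l1elt a -> zbound (fun k => supnorm (star a k)) (N1 a).
Proof.
move=> ha; apply: zbound_le (zbound_inj (@oppr_inj _) (L1_bound ha)) => k.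
apply: supnorm_le => // x; rewrite cabsJ.
exact: (cabs_supnorm (- k) _ ha).
Qed.

Lemma L1_star a : l1elt a -> l1elt (star a).
Proof.
move=> ha; apply: L1_intro (zbound_star ha) => k.
apply: contCJ; apply: contC_comp; [exact: L1_cont | exact: sigpow_cont].
Qed.

Lemma N1_star a : l1elt a -> N1 (star a) <= N1 a.
Proof. by move=> ha; apply/N1_le/zbound_star. Qed.

Lemma zbound_prod a b (f f' : int -> int) (g g' : int -> X) : l1elt a -> l1elt b -> injective f ->
  zbound (fun k => cabs (a (f k) (g k) * b (f' k) (g' k))) (N1 b * N1 a).
Proof.
move=> ha hb fi.
apply: zbound_le (zboundZ (N1_ge0 hb) (zbound_inj fi (L1_bound ha))) => k.
rewrite cabsM mulrC ler_pM ?cabs_ge0 ?cabs_N1 //.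
exact: (cabs_supnorm (f k) _ ha).
Qed.

Lemma zbound_conv a b n x : l1elt a -> l1elt b ->
  zbound (fun k => cabs (a k x * alphapow sigma sigmainv k (b (n - k)) x)) (N1 b * N1 a).
Proof. by move=> ha hb; exact: (zbound_prod (fun k => n - k) (fun=> x) (fun k => sp (- k) x) ha hb (@inj_id _)). Qed.

(** The tail of [a] bounds the tail of the convolution uniformly in [x], so the coefficient is a
    uniform limit of finite sums of continuous functions. *)
Lemma mul_cont a b n : l1elt a -> l1elt b -> contC (mul a b n).
Proof.
move=> ha hb; apply: contC_unif => e e0.
have Nb : 0 < N1 b + 1 by rewrite ltr_wpDl // N1_ge0.
have e1 : 0 < e / (N1 b + 1) by rewrite divr_gt0.
have [K HK] := zbound_tail (fun k => supnorm_ge0 Xcpt Xne (L1_cont ha k)) (L1_bound ha) e1.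
exists (fun x => \sum_(k <- rng K) a k x * alphapow sigma sigmainv k (b (n - k)) x).
  apply: contC_sum => k; apply: contCM; first exact: L1_cont.
  by apply: contC_comp; [exact: L1_cont | exact: sigpow_cont].
move=> x; rewrite cabsB; apply: zsum_tail (zbound_conv n x ha hb) _.
have := zboundZ (ltW Nb) HK; rewrite mulrCA divff ?gt_eqF // mulr1.
apply: zbound_le => k; case: ifP => _; rewrite ?mulr0 //.
rewrite cabsM mulrC ler_pM ?cabs_ge0 //.
  by rewrite (le_trans (cabs_N1 _ _ hb)) // lerDl.
exact: cabs_supnorm.
Qed.

Lemma cvg_bigsum (I : Type) (r : seq I) (u : I -> nat -> R) (l : I -> R) :
  (forall i, u i @ \oo --> l i) ->
  (fun n => \sum_(i <- r) u i n) @ \oo --> \sum_(i <- r) l i.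
Proof.
move=> H; elim: r => [|i r IH].
  by rewrite big_nil; under eq_fun do rewrite big_nil; exact: cvg_cst.
by rewrite big_cons; under eq_fun do rewrite big_cons; exact: cvgD.
Qed.

(** For partial convolutions the two finite sums can be exchanged; the inner sum is then over a
    translate of [b] and is at most [N1 b]. The bound survives the limit. *)
Lemma zbound_mul a b : l1elt a -> l1elt b ->
  zbound (fun n => supnorm (mul a b n)) (N1 a * N1 b).
Proof.
move=> ha hb; apply: zbound_supnorm => [n|x r ur]; first exact: mul_cont.
have H : (fun K => \sum_(n <- r) cabs (\sum_(k <- rng K)
    a k (x n) * alphapow sigma sigmainv k (b (n - k)) (x n))) @ \oo -->
    \sum_(n <- r) cabs (mul a b n (x n)).
  by apply: cvg_bigsum => n; apply: cvg_cabs; exact: cvg_zsum (zbound_conv n (x n) ha hb).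
rewrite -(cvg_lim _ H) //; apply: limr_le; first exact: cvgP H.
near=> K.
apply: (@le_trans _ _ (\sum_(n <- r) \sum_(k <- rng K) supnorm (a k) * supnorm (b (n - k)))).
  apply: ler_sum => n _; apply: le_trans (cabs_sum _ _) _.
  apply: ler_sum => k _; rewrite cabsM.
  by apply: ler_pM; rewrite ?cabs_ge0 //; [exact: cabs_supnorm | exact: (cabs_supnorm (n - k) _ hb)].
rewrite exchange_big /=.
apply: (@le_trans _ _ (\sum_(k <- rng K) supnorm (a k) * N1 b)).
  apply: ler_sum => k _; rewrite -mulr_sumr ler_wpM2l ?supnorm_ge0 //; first exact: L1_cont.
  by apply: (zbound_inj (f := fun n => n - k) _ (L1_bound hb)) => // i j /addIr.
rewrite -mulr_suml ler_wpM2r ?N1_ge0 //.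
by apply: L1_bound => //; exact: rng_uniq.
Unshelve. all: by end_near. Qed.

Lemma L1_mul a b : l1elt a -> l1elt b -> l1elt (mul a b).
Proof. by move=> ha hb; apply: L1_intro (zbound_mul ha hb) => n; exact: mul_cont. Qed.

Lemma N1_mul a b : l1elt a -> l1elt b -> N1 (mul a b) <= N1 a * N1 b.
Proof. by move=> ha hb; apply/N1_le/zbound_mul. Qed.

Lemma mulDl a b c : l1elt a -> l1elt b -> l1elt c -> mul (Ladd a b) c = Ladd (mul a c) (mul b c).
Proof.
move=> ha hb hc; apply: Lelt_eq => n x.
rewrite /Ladd -(zsumD (zbound_conv n x ha hc) (zbound_conv n x hb hc)).
by congr zsum; apply/funext => k; rewrite mulrDl.
Qed.

Lemma mulDr a b c : l1elt a -> l1elt b -> l1elt c -> mul a (Ladd b c) = Ladd (mul a b) (mul a c).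
Proof.
move=> ha hb hc; apply: Lelt_eq => n x.
rewrite /Ladd -(zsumD (zbound_conv n x ha hb) (zbound_conv n x ha hc)).
by congr zsum; apply/funext => k; rewrite -mulrDr.
Qed.

Lemma mulZl (z : C) a b : l1elt a -> l1elt b -> mul (Lscale z a) b = Lscale z (mul a b).
Proof.
move=> ha hb; apply: Lelt_eq => n x.
rewrite /Lscale -(zsumZ z (zbound_conv n x ha hb)).
by congr zsum; apply/funext => k; rewrite mulrA.
Qed.

Lemma mulZr (z : C) a b : l1elt a -> l1elt b -> mul a (Lscale z b) = Lscale z (mul a b).
Proof.
move=> ha hb; apply: Lelt_eq => n x.
rewrite /Lscale -(zsumZ z (zbound_conv n x ha hb)).
by congr zsum; apply/funext => k; rewrite /alphapow /= mulrCA.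
Qed.

Lemma mulBl a b c : l1elt a -> l1elt b -> l1elt c -> mul (Lsub a b) c = Lsub (mul a c) (mul b c).
Proof. by move=> ha hb hc; rewrite /Lsub (mulDl ha (L1_opp hb) hc) !LoppE (mulZl _ hb hc). Qed.

Lemma mulBr a b c : l1elt a -> l1elt b -> l1elt c -> mul a (Lsub b c) = Lsub (mul a b) (mul a c).
Proof. by move=> ha hb hc; rewrite /Lsub (mulDr ha hb (L1_opp hc)) !LoppE (mulZr _ ha hc). Qed.

Lemma mul_embl (f : X -> C) a n x : mul (Lemb f) a n x = f x * a n x.
Proof.
rewrite /Lmul (@zsum1 _ _ 0); first by rewrite /Lemb eqxx /alphapow /= oppr0 subr0.
by move=> k k0; rewrite /Lemb (negbTE k0) mul0r.
Qed.

Lemma mul_embr a (f : X -> C) n x : mul a (Lemb f) n x = a n x * f (sp (- n) x).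
Proof.
rewrite /Lmul (@zsum1 _ _ n); first by rewrite /Lemb subrr eqxx.
by move=> k kn; rewrite /alphapow /Lemb subr_eq0 eq_sym (negbTE kn) mulr0.
Qed.

Definition Lone : Lelt R X := Lemb (fun=> 1).

Lemma mul1L a : mul Lone a = a.
Proof. by apply: Lelt_eq => n x; rewrite mul_embl mul1r. Qed.

Lemma mulL1 a : mul a Lone = a.
Proof. by apply: Lelt_eq => n x; rewrite mul_embr mulr1. Qed.

Lemma supnorm0 : supnorm (fun _ : X => 0 : C) = 0.
Proof.
have [x [-> _]] := supnorm_attained Xcpt Xne (contC_cst (0 : C)).
exact: cabs0.
Qed.

Lemma L1_emb (f : X -> C) : contC f -> l1elt (Lemb f).
Proof.
move=> hf; apply: (@L1_intro _ (supnorm f)) => [k|r ur].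
  by rewrite /Lemb; case: (k == 0); [exact: hf | exact: (contC_cst (0 : C))].
rewrite (eq_bigr (fun k => if k == 0 then supnorm f else 0)); last first.
  by move=> k _; rewrite /Lemb; case: ifP => // _; rewrite supnorm0.
rewrite -big_mkcond /= -big_filter.
have : (size [seq k <- r | k == 0%R] <= 1)%N by rewrite size_filter count_uniq_mem // leq_b1.
case: [seq _ <- _ | _] => [|k [|//]]; rewrite ?big_nil ?big_seq1 // => _.
exact: supnorm_ge0.
Qed.

Lemma L1_one : l1elt Lone.
Proof. by apply: L1_emb; exact: contC_cst. Qed.

Lemma starD a b : star (Ladd a b) = Ladd (star a) (star b).
Proof. by apply: Lelt_eq => n x; rewrite /Lstar /Ladd /alphapow /= rmorphD. Qed.

Lemma starZ (z : C) a : star (Lscale z a) = Lscale z^* (star a).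
Proof. by apply: Lelt_eq => n x; rewrite /Lstar /Lscale /alphapow /= rmorphM. Qed.

Lemma starB a b : star (Lsub a b) = Lsub (star a) (star b).
Proof. by apply: Lelt_eq => n x; rewrite /Lstar /Lsub /Lopp /Ladd /alphapow /= rmorphB. Qed.

Lemma starK a : star (star a) = a.
Proof.
by apply: Lelt_eq => n x; rewrite /Lstar /alphapow /= conjCK !opprK sigpowK.
Qed.

Lemma star_emb (f : X -> C) : star (Lemb f) = Lemb (fun x => (f x)^*).
Proof.
apply: Lelt_eq => n x; rewrite /Lstar /alphapow /Lemb /= oppr_eq0.
by case: eqP => [->|_]; rewrite ?oppr0 // rmorph0.
Qed.

Lemma star1 : star Lone = Lone.
Proof. by rewrite star_emb; congr Lemb; apply/funext => x; rewrite rmorph1. Qed.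

Lemma starM a b : l1elt a -> l1elt b -> star (mul a b) = mul (star b) (star a).
Proof.
move=> ha hb; apply: Lelt_eq => n x.
rewrite {1}/Lstar /alphapow /= /Lmul.
rewrite -(zsum_conj (zbound_conv (- n) (sp (- n) x) ha hb)).
(* With [k + n] as index on the right, the two series agree term by term. *)
rewrite -(zsum_shift n (zbound_conv n x (L1_star hb) (L1_star ha))).
congr zsum; apply/funext => k; rewrite /Lstar /alphapow /= rmorphM mulrC.
rewrite -!(sigpowD sigmaK sigmainvK).
have -> : - (k + n) = - n - k by lia.
have -> : - k - n = - n - k by lia.
have -> : - (n + (- n - k)) = k by lia.
by have -> : k + (- n - k) = - n by lia.
Qed.

Definition Lrestr (r : seq int) a : Lelt R X := fun k => if k \in r then a k else (fun=> 0).

Lemma zbound_restr r a : l1elt a -> zbound (fun k => supnorm (Lrestr r a k)) (N1 a).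
Proof.
move=> ha; apply: zbound_le (L1_bound ha) => k; rewrite /Lrestr; case: (k \in r) => //.
by rewrite supnorm0 supnorm_ge0 //; exact: L1_cont.
Qed.

Lemma L1_restr r a : l1elt a -> l1elt (Lrestr r a).
Proof.
move=> ha; apply: L1_intro (zbound_restr r ha) => k; rewrite /Lrestr.
by case: (k \in r); [exact: L1_cont | exact: (contC_cst (0 : C))].
Qed.

Lemma restr_approx a (e : R) : l1elt a -> 0 < e ->
  exists K, N1 (Lsub a (Lrestr (rng K) a)) <= e.
Proof.
move=> ha e0.
have [K HK] := zbound_tail (fun k => supnorm_ge0 Xcpt Xne (L1_cont ha k)) (L1_bound ha) e0.
exists K; apply: N1_le; apply: zbound_le HK => k.
apply: supnorm_le => // x; rewrite /Lsub /Ladd /Lopp /Lrestr.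
case: (k \in rng K); first by rewrite subrr cabs0.
by rewrite subr0; exact: cabs_supnorm.
Qed.

Lemma mul_restrl r a b n x : uniq r ->
  mul (Lrestr r a) b n x = \sum_(k <- r) a k x * b (n - k) (sp (- k) x).
Proof.
move=> ur; rewrite /Lmul (zsum_fin ur).
  rewrite big_seq [RHS]big_seq; apply: eq_bigr => k kr.
  by rewrite /Lrestr kr.
by move=> k kr; rewrite /Lrestr (negbTE kr) mul0r.
Qed.

Lemma zsum_sum (I : Type) (r : seq I) (u : I -> int -> C) (W : R) :
  (forall i, zbound (fun k => cabs (u i k)) W) ->
  zsum (fun k => \sum_(i <- r) u i k) = \sum_(i <- r) zsum (u i).
Proof.
move=> H.
have [V HV] : exists V, zbound (fun k => cabs (\sum_(i <- r) u i k)) V /\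
   zsum (fun k => \sum_(i <- r) u i k) = \sum_(i <- r) zsum (u i); last by case: HV.
elim: r => [|i r [V [HV IH]]].
  exists 0; split.
    by move=> s us; rewrite big1 // => k _; rewrite big_nil cabs0.
  rewrite big_nil (@zsum_fin _ _ [::]) ?big_nil // => k _; by rewrite big_nil.
exists (W + V); split.
  by apply: zbound_le (zboundD (H i) HV) => k; rewrite big_cons cabsD.
rewrite big_cons -IH -(zsumD (H i) HV).
by congr zsum; apply/funext => k; rewrite big_cons.
Qed.

(** With a finitely supported left factor the double series is a finite sum of series, so no
    exchange of two infinite sums occurs. The general case follows by density. *)
Lemma restr_mulA r a b c : uniq r -> l1elt a -> l1elt b -> l1elt c ->
  mul (mul (Lrestr r a) b) c = mul (Lrestr r a) (mul b c).
Proof.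
move=> ur ha hb hc; apply: Lelt_eq => n x; rewrite (mul_restrl _ _ _ _ ur) {1}/Lmul.
pose t i j := b (j - i) (sp (- i) x) * c (n - j) (sp (- j) x).
have ht i : zbound (fun j => cabs (t i j)) (N1 c * N1 b).
  apply: (zbound_prod (f := fun j => j - i) (fun j => n - j) (fun=> sp (- i) x)
    (fun j => sp (- j) x) hb hc).
  by move=> j k /addIr.
rewrite (_ : (fun k => _) = fun j => \sum_(i <- r) a i x * t i j); last first.
  apply/funext => j; rewrite (mul_restrl _ _ _ _ ur) mulr_suml.
  by apply: eq_bigr => i _; rewrite -mulrA.
rewrite (@zsum_sum _ _ _ (N1 a * (N1 c * N1 b))).
  apply: eq_bigr => i _; rewrite (zsumZ _ (ht i)); congr (_ * _).
  rewrite -(zsum_shift i (ht i)) /Lmul; congr zsum; apply/funext => k.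
  rewrite /t /alphapow /= -(sigpowD sigmaK sigmainvK).
  have -> : k + i - i = k by lia.
  have -> : n - (k + i) = n - i - k by lia.
  by have -> : - (k + i) = - k - i by lia.
move=> i; apply: zbound_le (zboundZ (N1_ge0 ha) (ht i)) => j.
by rewrite cabsM ler_wpM2r ?cabs_ge0 ?cabs_N1.
Qed.

Lemma eq_N1 a b : l1elt a -> l1elt b -> (forall e : R, 0 < e -> N1 (Lsub a b) <= e) -> a = b.
Proof.
move=> ha hb H; apply: Lelt_eq => k x; apply/eqP; rewrite -subr_eq0; apply/eqP.
apply: cabs_eq0; apply/eqP; rewrite eq_le cabs_ge0 andbT; apply/ler_addgt0Pr => e e0.
rewrite add0r; apply: le_trans (H e e0).
exact: (cabs_N1 k x (L1_sub ha hb)).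
Qed.

Lemma mulLA a b c : l1elt a -> l1elt b -> l1elt c -> mul (mul a b) c = mul a (mul b c).
Proof.
have aux (x y z : R) : 0 <= x -> x * (2 * y + 1) <= z -> x * y + x * y <= z by nra.
move=> ha hb hc; have hab := L1_mul ha hb; have hbc := L1_mul hb hc.
apply: eq_N1 => [||e e0]; [exact: L1_mul | exact: L1_mul |].
(* The associator depends only on the tail [d] of [a] and is at most [2 * (N1 b * N1 c) * N1 d]; the
   added 1 keeps the divisor positive. *)
pose M := 2 * (N1 b * N1 c) + 1.
have M0 : 0 < M by rewrite ltr_wpDl // mulr_ge0 // mulr_ge0 // N1_ge0.
have [K HK] := restr_approx ha (divr_gt0 e0 M0).
set t := Lrestr (rng K) a in HK; set d := Lsub a t in HK.
have ht : l1elt t by exact: L1_restr.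
have hd : l1elt d by exact: L1_sub.
have -> : Lsub (mul (mul a b) c) (mul a (mul b c)) =
          Lsub (mul (mul d b) c) (mul d (mul b c)).
  have E : mul (mul t b) c = mul t (mul b c) by apply: restr_mulA => //; exact: rng_uniq.
  rewrite (mulBl ha ht hb) (mulBl ha ht hbc) (mulBl hab (L1_mul ht hb) hc) E.
  by apply: Lelt_eq => k x; rewrite /Lsub /Ladd /Lopp; ring.
have hdb := L1_mul hd hb.
have h1 : N1 (mul (mul d b) c) <= N1 d * (N1 b * N1 c).
  apply: le_trans (N1_mul hdb hc) _; rewrite mulrA ler_wpM2r ?N1_ge0 //.
  exact: N1_mul.
have h2 : N1 (mul d (mul b c)) <= N1 d * (N1 b * N1 c).
  apply: le_trans (N1_mul hd hbc) _; rewrite ler_wpM2l ?N1_ge0 //.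
  exact: N1_mul.
apply: le_trans (N1_add (L1_mul hdb hc) (L1_opp (L1_mul hd hbc))) _.
apply: le_trans (lerD h1 (le_trans (N1_opp (L1_mul hd hbc)) h2)) _.
have : N1 d * M <= e by rewrite -ler_pdivlMr.
have := N1_ge0 hd; rewrite /M; move: (N1 d) (N1 b * N1 c) => x y; exact: aux.
Qed.

Ltac l1 := lazymatch goal with
  | |- l1elt (Lmul _ _ _ _) => apply: L1_mul; l1
  | |- l1elt (Ladd _ _) => apply: L1_add; l1
  | |- l1elt (Lsub _ _) => apply: L1_sub; l1
  | |- l1elt (Lscale _ _) => apply: L1_scale; l1
  | |- l1elt (Lopp _) => apply: L1_opp; l1
  | |- l1elt (Lstar _ _ _) => apply: L1_star; l1
  | |- l1elt Lone => exact: L1_one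
  | |- l1elt (Lrestr _ _) => apply: L1_restr; l1
  | _ => assumption end.

(** Coefficients converge pointwise because [N1] dominates evaluations. As in Fatou's lemma, the
    distance to the limit is bounded by letting finitely many evaluations at arbitrary points
    converge; [zbound_supnorm] reassembles them. *)
Lemma N1_complete (y : nat -> Lelt R X) : (forall n, l1elt (y n)) ->
  (forall e : R, 0 < e -> exists N : nat, forall m n, (N <= m)%N -> (N <= n)%N ->
     N1 (Lsub (y m) (y n)) <= e) ->
  exists2 l, l1elt l & forall e : R, 0 < e -> exists N : nat, forall n, (N <= n)%N ->
     N1 (Lsub (y n) l) <= e.
Proof.
move=> hy H.
have hex (kx : int * X) : exists z : C, (fun n => y n kx.1 kx.2) @ \oo --> z.
  case: kx => k x /=; apply: cplx_cauchy_cvg => e e0.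
  have [N HN] := H _ (divr_gt0 e0 (ltr0Sn _ 1)); exists N => m n Nm Nn.
  apply: le_lt_trans (cabs_N1 k x (L1_sub (hy m) (hy n))) _.
  by apply: le_lt_trans (HN m n Nm Nn) _; rewrite ltr_pdivrMr // ltr_pMr // ltr1n.
have [l hl] := choice hex.
pose lf : Lelt R X := fun k x => l (k, x).
have key (e : R) N n : (forall m n, (N <= m)%N -> (N <= n)%N -> N1 (Lsub (y m) (y n)) <= e) ->
    (N <= n)%N -> forall (x : int -> X) r, uniq r ->
    \sum_(k <- r) cabs (Lsub (y n) lf k (x k)) <= e.
  move=> HN Nn x r ur.
  have hc : (fun m => \sum_(k <- r) cabs (Lsub (y n) (y m) k (x k))) @ \oo -->
      \sum_(k <- r) cabs (Lsub (y n) lf k (x k)).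
    apply: cvg_bigsum => k; apply: cvg_cabs; apply: cvgB; first exact: cvg_cst.
    exact: (hl (k, x k)).
  rewrite -(cvg_lim _ hc) //; apply: limr_le; first exact: cvgP hc.
  near=> m.
  have Nm : (N <= m)%N by near: m; exists N.
  apply: le_trans (HN n m Nn Nm); have hnm := L1_sub (hy n) (hy m).
  apply: le_trans (L1_bound hnm ur); apply: ler_sum => k _.
  exact: cabs_supnorm.
have lc k : contC (lf k).
  apply: contC_unif => e e0; have [N HN] := H _ e0.
  exists (y N k); first exact: L1_cont.
  by move=> x; have := key e N N HN (leqnn N) (fun=> x) [:: k] erefl; rewrite big_seq1.
have zb (e : R) N n : (forall m n, (N <= m)%N -> (N <= n)%N -> N1 (Lsub (y m) (y n)) <= e) ->
    (N <= n)%N -> zbound (fun k => supnorm (Lsub (y n) lf k)) e.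
  move=> HN Nn; apply: zbound_supnorm; last exact: key HN Nn.
  by move=> k; exact: contCB (L1_cont (hy n) k) (lc k).
exists lf; last first.
  by move=> e e0; have [N HN] := H _ e0; exists N => n Nn; exact: N1_le (zb e N n HN Nn).
have [N HN] := H 1 ltr01.
apply: (L1_of_sub (hy N)); apply: L1_intro (zb 1 N N HN (leqnn N)) => k.
exact: contCB (L1_cont (hy N) k) (lc k).
Unshelve. all: by end_near. Qed.

(** The common ground of l^1(Sigma) and the commutant: [good_closed] keeps square roots in [S], and
    [good_restr] allows the reduction to finite support. *)
Record good_subalgebra (S : set (Lelt R X)) : Prop := GoodSubalgebra {
  good_L1 : forall a, S a -> l1elt a;
  good_one : S Lone;
  good_add : forall a b, S a -> S b -> S (Ladd a b);
  good_scale : forall z a, S a -> S (Lscale z a);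
  good_mul : forall a b, S a -> S b -> S (mul a b);
  good_star : forall a, S a -> S (star a);
  good_restr : forall r a, S a -> S (Lrestr r a);
  good_closed : forall a, l1elt a ->
    (forall e : R, 0 < e -> exists2 b, S b & N1 (Lsub a b) <= e) -> S a }.

Lemma N1_prox a b : l1elt a -> l1elt b -> N1 a <= N1 b + N1 (Lsub a b).
Proof.
move=> ha hb; rewrite {1}(_ : a = Ladd b (Lsub a b)); first by apply: N1_add; l1.
by apply: Lelt_eq => k x; rewrite /Ladd /Lsub /Ladd /Lopp addrC subrK.
Qed.

(** * The square root of 1 - h^2 as a fixed point *)

Section SquareRoot.
Variable S : set (Lelt R X).
Hypothesis gS : good_subalgebra S.

Section Iteration.
Variables h : Lelt R X.
Hypotheses (hS : S h) (hstar : star h = h) (hN : N1 h < 1).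

Let x := mul h h.
(** A fixed point [l] satisfies (1 - l)^2 = 1 - x. On the ball of radius [N1 h] the map is a
    contraction of ratio [N1 h], and it preserves the conditions of [inv]. *)
Let step y : Lelt R X := Lscale (cofr (2^-1)) (Ladd x (mul y y)).
Let inv y : Prop := [/\ S y, star y = y, mul h y = mul y h & N1 y <= N1 h].

Let hL : l1elt h. Proof. exact: (good_L1 gS). Qed.
Let xL : l1elt x. Proof. by rewrite /x; l1. Qed.
Let half_ge0 : 0 <= 2^-1 :> R. Proof. by rewrite invr_ge0. Qed.

Let xN : N1 x <= N1 h.
Proof.
by apply: le_trans (N1_mul hL hL) _; rewrite ler_piMl ?N1_ge0 // ltW.
Qed.

Let inv_x : inv x.
Proof.
split=> //; first exact: good_mul.
  by rewrite /x (starM hL hL) hstar.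
by rewrite /x (mulLA hL hL hL).
Qed.

Let inv_step y : inv y -> inv (step y).
Proof.
move=> [yS ys yh yN]; have yL := good_L1 gS yS; have yyL : l1elt (mul y y) by l1.
split.
- by apply: good_scale => //; apply: good_add => //; apply: good_mul.
- by rewrite /step starZ starD (starM yL yL) ys cofr_conj; case: inv_x => _ ->.
- have xyyL : l1elt (Ladd x (mul y y)) by l1.
  rewrite /step (mulZr _ hL xyyL) (mulZl _ xyyL hL) (mulDr hL xL yyL) (mulDl xL yyL hL).
  case: inv_x => _ _ -> _.
  by rewrite -(mulLA hL yL yL) yh (mulLA yL hL yL) yh -(mulLA yL yL hL).
- apply: le_trans (N1_scale _ _) _; first by l1.
  rewrite cabs_cofr // mulrC ler_pdivrMr //.
  apply: le_trans (N1_add xL yyL) _; rewrite mulr_natr mulr2n lerD //.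
  apply: le_trans (N1_mul yL yL) _; apply: (le_trans _ yN).
  by rewrite ler_piMl ?N1_ge0 // (le_trans yN) // ltW.
Qed.

Let step_contr y z : inv y -> inv z ->
  N1 (Lsub (step y) (step z)) <= N1 h * N1 (Lsub y z).
Proof.
move=> [yS _ _ yN] [zS _ _ zN].
have yL := good_L1 gS yS; have zL := good_L1 gS zS.
(* The difference y^2 - z^2 is y (y - z) + (y - z) z, an identity that holds without
   commutativity. *)
have -> : Lsub (step y) (step z) =
    Lscale (cofr (2^-1)) (Ladd (mul y (Lsub y z)) (mul (Lsub y z) z)).
  rewrite (mulBr yL yL zL) (mulBl yL zL zL); apply: Lelt_eq => k t.
  by rewrite /step /Lscale /Lsub /Ladd /Lopp; ring.
have dL : l1elt (Lsub y z) by l1.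
apply: le_trans (N1_scale _ _) _; first by l1.
rewrite cabs_cofr // mulrC ler_pdivrMr //.
apply: le_trans (N1_add (L1_mul yL dL) (L1_mul dL zL)) _; rewrite mulr_natr mulr2n lerD //.
  by apply: le_trans (N1_mul yL dL) _; rewrite ler_wpM2r ?N1_ge0.
by apply: le_trans (N1_mul dL zL) _; rewrite mulrC ler_wpM2r ?N1_ge0.
Qed.

Let y n := iter n step x.

Let inv_y n : inv (y n).
Proof. by elim: n => [|n IH] //=; exact: inv_step. Qed.

Let yL n : l1elt (y n).
Proof. by case: (inv_y n) => /(good_L1 gS). Qed.

(** Both iterates arise in [n] steps from [y k] and [y 0], which are at distance at most 2; no
    geometric series is summed. *)
Let y_contr n k : N1 (Lsub (y (n + k)) (y n)) <= N1 h ^+ n * 2.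
Proof.
elim: n => [|n IH].
  rewrite expr0 mul1r add0n; have [_ _ _ yN] := inv_y k; have [_ _ _ zN] := inv_y 0.
  apply: le_trans (N1_add (yL k) (L1_opp (yL 0))) _; rewrite -[2]/(1 + 1)%:R natrD.
  apply: lerD; first by rewrite (le_trans yN) // ltW.
  by rewrite (le_trans (N1_opp (yL 0))) // (le_trans zN) // ltW.
rewrite addSn /= exprS -mulrA; apply: le_trans (step_contr (inv_y _) (inv_y _)) _.
by rewrite ler_wpM2l ?N1_ge0.
Qed.

Lemma sqrt_fixpoint : exists l, inv l /\ step l = l.
Proof.
have cauchy (e : R) : 0 < e -> exists N : nat, forall m n, (N <= m)%N -> (N <= n)%N ->
     N1 (Lsub (y m) (y n)) <= e.
  move=> e0.
  (* Both [y m] and [y n] will be compared with [y N], at a cost of [N1 h ^+ N * 2] each. *)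
  have [N HN] : exists N : nat, N1 h ^+ N * 4 <= e.
    have /cvgrPdist_lt /(_ (e / 4)) : (fun n => N1 h ^+ n) @ \oo --> (0 : R).
      by apply: cvg_expr; rewrite ger0_norm // N1_ge0.
    case; first by rewrite divr_gt0.
    move=> N _ /(_ N (leqnn N)) /=; rewrite sub0r normrN ger0_norm ?exprn_ge0 ?N1_ge0 //.
    by move=> /ltW; rewrite ler_pdivlMr // => HN; exists N.
  exists N => m n Nm Nn.
  apply: le_trans (N1_tri (yL m) (yL N) (yL n)) _.
  rewrite (N1_subC (yL N) (yL n)) -(subnKC Nm) -(subnKC Nn).
  apply: le_trans (lerD (y_contr _ _) (y_contr _ _)) _.
  by rewrite -mulrDr -natrD.
have [l lL hl] := N1_complete yL cauchy.
have near_l (e : R) : 0 < e ->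
    exists z, [/\ inv z, N1 (Lsub z l) <= e & N1 (Lsub (step z) l) <= e].
  by move=> e0; have [N HN] := hl e e0; exists (y N); split; [|exact: HN|exact: (HN N.+1)].
have sS : S l.
  apply: good_closed => // e e0; have [z [[zS _ _ _] hz _]] := near_l e e0.
  by exists z => //; rewrite N1_subC //; exact: (good_L1 gS).
have il : inv l.
  split=> //.
  - apply: eq_N1 => // [|e e0]; first by l1.
    have [z [[zS zs _ _] hz _]] := near_l _ (divr_gt0 e0 (ltr0Sn _ 1)).
    have zL := good_L1 gS zS; have slL : l1elt (star l) by l1.
    apply: le_trans (N1_tri slL zL lL) _; rewrite [e]splitr lerD //.
    rewrite -[in leLHS]zs -starB; apply: le_trans (N1_star _) _; first by l1.
    by rewrite N1_subC.
  - apply: eq_N1 => [||e e0]; [by l1|by l1|].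
    have [z [[zS _ zh _] hz _]] := near_l _ (divr_gt0 e0 (ltr0Sn _ 1)).
    have zL := good_L1 gS zS; have hzL : l1elt (mul h z) by l1.
    have hlL : l1elt (mul h l) by l1.
    have lhL : l1elt (mul l h) by l1.
    apply: le_trans (N1_tri hlL hzL lhL) _; rewrite [e]splitr lerD //.
      rewrite -(mulBr hL lL zL); have lzL : l1elt (Lsub l z) by l1.
      apply: le_trans (N1_mul hL lzL) _; rewrite N1_subC // (le_trans _ hz) //.
      by rewrite ler_piMl ?N1_ge0 ?ltW //; l1.
    rewrite zh -(mulBl zL lL hL); have zlL : l1elt (Lsub z l) by l1.
    apply: le_trans (N1_mul zlL hL) _; rewrite (le_trans _ hz) //.
    by rewrite ler_piMr ?N1_ge0 ?ltW //; l1.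
  - apply/ler_addgt0Pr => e e0; have [z [[zS _ _ zN] hz _]] := near_l e e0.
    have zL := good_L1 gS zS.
    apply: le_trans (N1_prox lL zL) _; rewrite lerD //.
    by rewrite N1_subC.
exists l; split=> //; have [slS _ _ _] := inv_step il.
have slL := good_L1 gS slS.
apply: eq_N1 => // e e0.
have [z [iz hz hsz]] := near_l _ (divr_gt0 e0 (ltr0Sn _ 1)).
have [szS _ _ _] := inv_step iz; have szL := good_L1 gS szS.
have [zS _ _ _] := iz; have zL := good_L1 gS zS.
apply: le_trans (N1_tri slL szL lL) _; rewrite [e]splitr lerD //.
apply: le_trans (step_contr il iz) _; rewrite N1_subC // (le_trans _ hz) //.
by rewrite ler_piMl ?N1_ge0 ?ltW //; l1.
Qed.

Lemma sqrt_one_minus_sqr : exists s, [/\ S s, star s = s, mul h s = mul s h &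
  mul s s = Lsub Lone (mul h h)].
Proof.
have [l [[lS ls lh _] sl]] := sqrt_fixpoint.
have lL := good_L1 gS lS; have oL := L1_one.
exists (Lsub Lone l); split.
- rewrite /Lsub LoppE; apply: good_add => //; first exact: good_one.
  exact: good_scale.
- by rewrite starB star1 ls.
- by rewrite (mulBr hL oL lL) (mulBl oL lL hL) mul1L mulL1 lh.
- have dL : l1elt (Lsub Lone l) by l1.
  rewrite (mulBl oL lL dL) mul1L (mulBr lL oL lL) mulL1.
  apply: Lelt_eq => k t; move: (congr1 (fun a => a k t) sl).
  rewrite /step /Lscale /Ladd /Lsub /Ladd /Lopp -/x => E.
  have h2 : cofr (2^-1) + cofr (2^-1) = (1 : C).
    by rewrite -cofrD (_ : 2^-1 + 2^-1 = 1) //; lra.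
  have E2 : l k t + l k t = x k t + mul l l k t by rewrite -{1 2}E -mulrDl h2 mul1r.
  have -> : Lone k t - l k t - (l k t - mul l l k t) = Lone k t - (l k t + l k t) + mul l l k t.
    by ring.
  by rewrite E2; ring.
Qed.

End Iteration.
End SquareRoot.

(** * Domination of C*-seminorms by the l^1-norm *)

Section Contractive.
Variables (S : set (Lelt R X)) (p : Lelt R X -> R).
Hypothesis gS : good_subalgebra S.
Hypothesis hp : cstar_seminorm sigma sigmainv S p.

(** The C*-identity makes [p Lone] its own square, hence 0 or 1. *)
Lemma seminorm_one : p Lone <= 1.
Proof.
case: hp => p0 _ _ _ pS; have := pS _ (good_one gS); have := p0 _ (good_one gS).
rewrite star1 mul1L; move: (p Lone) => t t0 tt.
by rewrite leNgt; apply/negP => t1; nra.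
Qed.

Lemma seminorm_unitary u : S u -> mul (star u) u = Lone -> p u <= 1.
Proof.
move=> uS uu; case: hp => p0 _ _ _ pS.
by rewrite -(@expr_le1 _ 2) ?p0 // -pS // uu; exact: seminorm_one.
Qed.

Lemma seminorm_selfadjoint_le1 h : S h -> star h = h -> N1 h < 1 -> p h <= 1.
Proof.
move=> hS hs hN; have [s [sS ss sh s2]] := sqrt_one_minus_sqr gS hS hs hN.
have hL := good_L1 gS hS; have sL := good_L1 gS sS.
pose u (z : C) := Ladd h (Lscale z s).
have uS z : S (u z) by apply: (good_add gS) => //; exact: (good_scale gS).
(* The mixed terms cancel since [h] and [s] commute and [w = - z]; what remains is h^2 + s^2 = 1.
   Applied with [z] equal to i and to -i. *)
have uu (z w : C) : w = - z -> z * w = 1 -> mul (u z) (u w) = Lone.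
  move=> wz zw.
  have zsL t : l1elt (Lscale t s) by l1.
  rewrite /u (mulDl hL (zsL z) (L1_add hL (zsL w))) (mulDr hL hL (zsL w)) (mulDr (zsL z) hL (zsL w)).
  rewrite (mulZr w hL sL) (mulZl z sL hL) (mulZl z sL (zsL w)) (mulZr w sL sL) s2 sh.
  apply: Lelt_eq => k x; rewrite /Ladd /Lscale /Lsub /Ladd /Lopp (mulrA z w) zw wz.
  by ring.
have [i ii ci] : exists2 i : C, - i * i = 1 & i^* = - i.
  by exists 'i; [rewrite mulNr -expr2 sqrCi opprK | exact: conjCi].
have pu : p (u i) <= 1.
  apply: seminorm_unitary => //.
  rewrite {1}/u starD starZ hs ss ci -/(u _); apply: uu => //.
  by rewrite opprK.
have pv : p (u (- i)) <= 1.
  apply: seminorm_unitary => //.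
  rewrite {1}/u starD starZ hs ss rmorphN /= ci opprK -/(u _); apply: uu => //.
  by rewrite mulrC.
have -> : h = Lscale (cofr (2^-1)) (Ladd (u i) (u (- i))).
  apply: Lelt_eq => k x; rewrite /u /Lscale /Ladd.
  have h2 : cofr (2^-1) + cofr (2^-1) = (1 : C).
    by rewrite -cofrD (_ : 2^-1 + 2^-1 = 1) //; lra.
  rewrite -[LHS]mul1r -h2; ring.
case: hp => p0 pD pZ _ _; rewrite pZ; last exact: (good_add gS).
rewrite cabs_cofr ?invr_ge0 // mulrC ler_pdivrMr // mul1r.
by apply: le_trans (pD _ _ (uS _) (uS _)) _; lra.
Qed.

Lemma seminorm_selfadjoint h : S h -> star h = h -> p h <= N1 h.
Proof.
move=> hS hs; apply/ler_addgt0Pr => e e0; have hL := good_L1 gS hS.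
(* Dividing by [N1 h + e] rather than by [N1 h] gives a norm strictly below 1 and covers the case of
   norm 0. *)
have t0 : 0 < N1 h + e by rewrite ltr_wpDl // N1_ge0.
have ti : 0 <= (N1 h + e)^-1 by rewrite invr_ge0 ltW.
have : p (Lscale (cofr (N1 h + e)^-1) h) <= 1.
  apply: seminorm_selfadjoint_le1; first exact: (good_scale gS).
    by rewrite starZ hs cofr_conj.
  apply: le_lt_trans (N1_scale _ hL) _.
  by rewrite cabs_cofr // mulrC ltr_pdivrMr // mul1r ltrDl.
case: hp => p0 pD pZ _ _; rewrite pZ // cabs_cofr //.
by rewrite mulrC ler_pdivrMr // mul1r.
Qed.

(** The C*-identity reduces the estimate to the self-adjoint element a^* a. *)
Lemma seminorm_le_N1 a : S a -> p a <= N1 a.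
Proof.
move=> aS; have aL := good_L1 gS aS; case: hp => p0 _ _ _ pS.
have saS : S (mul (star a) a) by apply: (good_mul gS) => //; exact: (good_star gS).
rewrite -(@ler_pXn2r _ 2) ?nnegrE ?p0 ?N1_ge0 // -pS //.
apply: le_trans (seminorm_selfadjoint saS _) _; first by rewrite starM ?starK //; exact: L1_star.
apply: le_trans (N1_mul (L1_star aL) aL) _.
by rewrite expr2 ler_wpM2r ?N1_ge0 // N1_star.
Qed.

End Contractive.

(** * The norm of the regular representations along the orbits *)

Section RegularNorm.

(** The sesquilinear form of the regular representation at [x], tested on finitely supported
    vectors: [xi] counts only on [s] and [eta] only on [r]. *)
Definition orbform a x (r s : seq int) (xi eta : int -> C) : C :=
  \sum_(m <- r) \sum_(k <- s) (eta m)^* * a (m - k) (sp m x) * xi k.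

Definition sqnorm (r : seq int) (xi : int -> C) : R := \sum_(k <- r) cabs (xi k) ^+ 2.

(* By rescaling [xi] and [eta] this is the operator bound [|<A xi, eta>| <= M |xi| |eta|]
   for the matrix [A m k = a (m - k) (sigma^m x)]; the additive form needs no Cauchy-Schwarz. *)
Definition opbound a (M : R) := forall x r s xi eta, uniq r -> uniq s ->
  cabs (orbform a x r s xi eta) <= M / 2 * (sqnorm r eta + sqnorm s xi).

Definition regnorm a : R := inf [set M | 0 < M /\ opbound a M].

Lemma sqnorm_ge0 r xi : 0 <= sqnorm r xi.
Proof. by apply: sumr_ge0 => k _; rewrite sqr_ge0. Qed.

Lemma sqnormZ (t : R) r xi : 0 <= t ->
  sqnorm r (fun k => cofr t * xi k) = t ^+ 2 * sqnorm r xi.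
Proof.
by move=> t0; rewrite /sqnorm mulr_sumr; apply: eq_bigr => k _; rewrite cabsM cabs_cofr // exprMn.
Qed.

Lemma sqnorm_sub r s xi : uniq r -> uniq s -> {subset r <= s} -> sqnorm r xi <= sqnorm s xi.
Proof. by move=> ur us rs; apply: ler_sum_sub => // k; rewrite sqr_ge0. Qed.

Lemma amgm (x y t : R) : 0 < t -> x * y <= 2^-1 * (t * x ^+ 2 + t^-1 * y ^+ 2).
Proof.
move=> t0; rewrite ler_pdivlMl // -subr_ge0.
rewrite (_ : _ - _ = t * (x - t^-1 * y) ^+ 2); first by rewrite mulr_ge0 ?sqr_ge0 // ltW.
by field; rewrite gt_eqF.
Qed.

(** This is the Schur test: each row and each column of the matrix has absolute sum at most
    [N1 a]. *)
Lemma opbound_N1 a : l1elt a -> opbound a (N1 a).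
Proof.
move=> ha x r s xi eta ur us.
pose w m k := supnorm (a (m - k)).
have w0 m k : 0 <= w m k by apply: supnorm_ge0 => //; exact: L1_cont.
apply: (@le_trans _ _ (\sum_(m <- r) \sum_(k <- s)
   (2^-1 * (cabs (eta m) ^+ 2 * w m k) + 2^-1 * (w m k * cabs (xi k) ^+ 2)))).
  apply: le_trans (cabs_sum _ _) _; apply: ler_sum => m _.
  apply: le_trans (cabs_sum _ _) _; apply: ler_sum => k _.
  rewrite !cabsM cabsJ.
  have h1 : cabs (a (m - k) (sp m x)) <= w m k by exact: cabs_supnorm.
  have h2 := @amgm (cabs (eta m)) (cabs (xi k)) 1 ltr01.
  rewrite invr1 !mul1r in h2.
  have e0 := cabs_ge0 (eta m); have x0 := cabs_ge0 (xi k).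
  apply: (@le_trans _ _ (w m k * (cabs (eta m) * cabs (xi k)))).
    by rewrite mulrAC mulrC ler_wpM2r // mulr_ge0.
  apply: le_trans (ler_wpM2l (w0 m k) h2) _.
  by rewrite le_eqVlt; apply/orP; left; apply/eqP; ring.
under eq_bigr do rewrite big_split /= -!mulr_sumr.
rewrite big_split /= -!mulr_sumr -mulrDr.
rewrite (_ : N1 a / 2 * _ = 2^-1 * (N1 a * sqnorm r eta + N1 a * sqnorm s xi)); last by ring.
rewrite ler_wpM2l ?invr_ge0 // lerD //.
  rewrite /sqnorm mulr_sumr; apply: ler_sum => m _; rewrite mulrC ler_wpM2r ?sqr_ge0 //.
  by apply: (zbound_inj (f := fun k => m - k) _ (L1_bound ha)) => // i j /addrI /oppr_inj.
rewrite exchange_big /= /sqnorm mulr_sumr; apply: ler_sum => k _.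
rewrite -mulr_suml ler_wpM2r ?sqr_ge0 //.
by apply: (zbound_inj (f := fun m => m - k) _ (L1_bound ha)) => // i j /addIr.
Qed.

Lemma opbound_le a (M M' : R) : M <= M' -> opbound a M -> opbound a M'.
Proof.
move=> MM H x r s xi eta ur us; apply: le_trans (H x r s xi eta ur us) _.
by rewrite ler_wpM2r ?addr_ge0 ?sqnorm_ge0 // ler_pM2r ?invr_gt0.
Qed.

(** Multiplying [eta] by the square root of [t] and dividing [xi] by it leaves the form unchanged.
    The free weight [t] takes the place of the Cauchy-Schwarz inequality. *)
Lemma opbound_scaled a (M t : R) x r s xi eta : opbound a M -> 0 < t -> uniq r -> uniq s ->
  cabs (orbform a x r s xi eta) <= M / 2 * (t * sqnorm r eta + t^-1 * sqnorm s xi).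
Proof.
move=> H t0 ur us; pose c := Num.sqrt t.
have c0 : 0 < c by rewrite sqrtr_gt0.
have ci : 0 <= c^-1 by rewrite invr_ge0 ltW.
have c2 : c ^+ 2 = t by rewrite sqr_sqrtr // ltW.
have := H x r s (fun k => cofr c^-1 * xi k) (fun m => cofr c * eta m) ur us.
rewrite (sqnormZ s xi ci) (sqnormZ r eta (ltW c0)) exprVn c2; congr (cabs _ <= _).
apply: eq_bigr => m _; apply: eq_bigr => k _; rewrite rmorphM /= cofr_conj.
rewrite (_ : _ * _ * _ = (cofr c * cofr c^-1) * ((eta m)^* * a (m - k) (sp m x) * xi k)); last by ring.
by rewrite -cofrM divff ?gt_eqF // mul1r.
Qed.

(** The value [a n x] is the matrix entry in row 0 and column [- n], so two basis vectors detect
    it. *)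
Lemma opbound_entry a (M : R) n x : opbound a M -> cabs (a n x) <= M.
Proof.
move=> /(_ x [:: 0] [:: - n] (fun=> 1) (fun=> 1) erefl erefl).
rewrite /orbform /sqnorm !big_seq1 rmorph1 mul1r mulr1 sub0r opprK cabs1 expr1n.
by rewrite (_ : M / 2 * (1 + 1) = M) //; field.
Qed.

Lemma regnorm_le a (M : R) : 0 <= M -> (forall e, 0 < e -> opbound a (M + e)) -> regnorm a <= M.
Proof.
move=> M0 H; apply/ler_addgt0Pr => e e0; apply: ge_inf; first by exists 0 => x [/ltW].
by split; [rewrite ltr_wpDl | exact: H].
Qed.

Lemma regnorm_ge0 a : 0 <= regnorm a.
Proof.
have [[M HM]|nM] := pselect ([set M | 0 < M /\ opbound a M] !=set0).
  by apply: lb_le_inf; [exists M | move=> x [/ltW]].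
(* Without any bound the infimum is that of the empty set, 0 by convention. *)
rewrite /regnorm (_ : [set M | _] = set0) ?inf0 //.
by apply/seteqP; split=> // x hx; apply: nM; exists x.
Qed.

Lemma regnorm_opbound a (e : R) : l1elt a -> 0 < e -> opbound a (regnorm a + e).
Proof.
move=> ha e0.
have hi : has_inf [set M | 0 < M /\ opbound a M].
  split; last by exists 0 => x [/ltW].
  exists (N1 a + 1); split; first by rewrite ltr_wpDl // N1_ge0.
  by apply: opbound_le (opbound_N1 ha); rewrite lerDl.
have [M [_ HM] hM] := inf_adherent e0 hi.
exact: opbound_le (ltW hM) HM.
Qed.

Lemma regnorm_le_N1 a : l1elt a -> regnorm a <= N1 a.
Proof.
move=> ha; apply: regnorm_le (N1_ge0 ha) _ => e e0.
by apply: opbound_le (opbound_N1 ha); rewrite lerDl ltW.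
Qed.

Lemma regnorm_entry a n x : l1elt a -> cabs (a n x) <= regnorm a.
Proof.
by move=> ha; apply/ler_addgt0Pr => e e0; exact: opbound_entry (regnorm_opbound ha e0).
Qed.

Lemma opbound_add a b (M M' : R) : opbound a M -> opbound b M' -> opbound (Ladd a b) (M + M').
Proof.
move=> H H' x r s xi eta ur us.
rewrite (_ : orbform _ _ _ _ _ _ = orbform a x r s xi eta + orbform b x r s xi eta).
  apply: le_trans (cabsD _ _) _; rewrite !mulrDl.
  by rewrite lerD ?H ?H'.
rewrite /orbform -big_split /=; apply: eq_bigr => m _; rewrite -big_split /=.
by apply: eq_bigr => k _; rewrite /Ladd; ring.
Qed.

Lemma opbound_scale (z : C) a (M : R) : opbound a M -> opbound (Lscale z a) (cabs z * M).
Proof.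
move=> H x r s xi eta ur us.
rewrite (_ : orbform _ _ _ _ _ _ = z * orbform a x r s xi eta).
  by rewrite cabsM -!mulrA ler_wpM2l ?cabs_ge0 // mulrA H.
rewrite /orbform mulr_sumr; apply: eq_bigr => m _; rewrite mulr_sumr.
by apply: eq_bigr => k _; rewrite /Lscale; ring.
Qed.

Lemma orbform_star a x r s xi eta :
  orbform (star a) x r s xi eta = (orbform a x s r eta xi)^*.
Proof.
rewrite /orbform exchange_big rmorph_sum; apply: eq_bigr => k _.
rewrite rmorph_sum; apply: eq_bigr => m _; rewrite /Lstar /alphapow /=.
rewrite -(sigpowD sigmaK sigmainvK) !rmorphM /= conjCK.
have -> : - (m - k) + m = k by lia.
have -> : - (m - k) = k - m by lia.
ring.
Qed.

Lemma opbound_star a (M : R) : opbound a M -> opbound (star a) M.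
Proof.
move=> H x r s xi eta ur us; rewrite orbform_star cabsJ.
by rewrite (le_trans (H _ _ _ _ _ us ur)) // addrC.
Qed.

Definition orbact b x (s : seq int) (xi : int -> C) : int -> C :=
  fun l => \sum_(k <- s) b (l - k) (sp l x) * xi k.

Lemma orbform_act a x r s xi eta :
  orbform a x r s xi eta = \sum_(m <- r) (eta m)^* * orbact a x s xi m.
Proof.
apply: eq_bigr => m _; rewrite /orbact mulr_sumr.
by apply: eq_bigr => k _; rewrite mulrA.
Qed.

Lemma orbform_act_self a x r s xi :
  orbform a x r s xi (orbact a x s xi) = cofr (sqnorm r (orbact a x s xi)).
Proof.
rewrite orbform_act /sqnorm; elim: r => [|m r IH]; first by rewrite !big_nil.
by rewrite !big_cons cofrD -IH mul_conj.
Qed.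

(** Multiplicativity of the regular representation: reflecting the summation index at [m] turns the
    convolution into the product of the two orbit matrices. *)
Lemma mul_entry a b m k x : l1elt a -> l1elt b ->
  mul a b (m - k) (sp m x) = zsum (fun l => a (m - l) (sp m x) * b (l - k) (sp l x)).
Proof.
move=> ha hb; rewrite /Lmul -(zsum_reflect m (zbound_conv (m - k) (sp m x) ha hb)).
congr zsum; apply/funext => l; rewrite /alphapow /= -(sigpowD sigmaK sigmainvK).
have -> : m - k - (m - l) = l - k by lia.
by have -> : - (m - l) + m = l by lia.
Qed.

Lemma cvg_csum (I : Type) (r : seq I) (u : I -> nat -> C) (l : I -> C) :
  (forall i, u i @ \oo --> l i) ->
  (fun n => \sum_(i <- r) u i n) @ \oo --> \sum_(i <- r) l i.
Proof.
move=> H; elim: r => [|i r IH].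
  by rewrite big_nil; under eq_fun do rewrite big_nil; exact: cvg_cst.
by rewrite big_cons; under eq_fun do rewrite big_cons; exact: cvgD (H i) IH.
Qed.

(** The intermediate vector [orbact b x s xi] has infinite support in general; cutting it to [rng L]
    keeps all forms finite, and the product appears in the limit. *)
Lemma cvg_orbform_mul a b x r s xi eta : l1elt a -> l1elt b ->
  (fun L => orbform a x r (rng L) (orbact b x s xi) eta) @ \oo -->
  orbform (mul a b) x r s xi eta.
Proof.
move=> ha hb.
rewrite (_ : (fun L => _) = fun L => \sum_(m <- r) \sum_(k <- s)
   (eta m)^* * (\sum_(l <- rng L) a (m - l) (sp m x) * b (l - k) (sp l x)) * xi k).
  apply: cvg_csum => m; apply: cvg_csum => k; apply: cvgM; last exact: cvg_cst.
  apply: cvgM; first exact: cvg_cst.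
  rewrite (mul_entry m k x ha hb); apply: cvg_zsum.
  by apply: (zbound_prod (f := fun l => m - l) (fun l => l - k) (fun=> sp m x)
    (fun l => sp l x) ha hb) => i j /addrI /oppr_inj.
apply/funext => L; apply: eq_bigr => m _.
under eq_bigr do rewrite /orbact mulr_sumr.
rewrite exchange_big /=; apply: eq_bigr => k _.
by rewrite mulr_sumr mulr_suml; apply: eq_bigr => l _; ring.
Qed.

(** Testing the form on the image itself with weight 1/M gives u <= (u + M^2 v) / 2, where u and v
    are the two squared norms. *)
Lemma sqnorm_act b (M : R) x r s xi : opbound b M -> 0 < M -> uniq r -> uniq s ->
  sqnorm r (orbact b x s xi) <= M ^+ 2 * sqnorm s xi.
Proof.
move=> H M0 ur us.
have Mi : 0 < M^-1 by rewrite invr_gt0.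
have := opbound_scaled x xi (orbact b x s xi) H Mi ur us.
rewrite orbform_act_self cabs_cofr ?sqnorm_ge0 // invrK.
move: (sqnorm r _) (sqnorm s _) => u v.
rewrite (_ : M / 2 * _ = 2^-1 * (u + M ^+ 2 * v)); last by field; rewrite gt_eqF.
lra.
Qed.

Lemma opbound_mul a b (M M' : R) : l1elt a -> l1elt b -> 0 < M' ->
  opbound a M -> 0 <= M -> opbound b M' -> opbound (mul a b) (M * M').
Proof.
move=> ha hb M'0 Ha M0 Hb x r s xi eta ur us.
apply: cabs_cvg_le (@cvg_orbform_mul a b x r s xi eta ha hb) _ => L.
(* The weight [M'] balances the factor [M' ^+ 2] that [sqnorm_act] puts on the side of [xi]. *)
have := opbound_scaled x (orbact b x s xi) eta Ha M'0 ur (rng_uniq L).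
move=> /le_trans; apply.
have := sqnorm_act x xi Hb M'0 (rng_uniq L) us.
move: (sqnorm (rng L) _) (sqnorm r _) (sqnorm s _) => u v w huw.
rewrite (_ : M * M' / 2 * (v + w) = M / 2 * (M' * v + M'^-1 * (M' ^+ 2 * w))); last first.
  by field; rewrite gt_eqF.
by rewrite ler_wpM2l ?divr_ge0 // lerD2l ler_wpM2l // invr_ge0 ltW.
Qed.

(** The nontrivial half of the C*-identity: the squared norm of A xi is the form of A^* A at (xi,
    xi). It is reached as a limit of increasing partial sums, each of which is therefore bounded by
    it. *)
Lemma opbound_sqrt a (M : R) : l1elt a -> 0 < M -> opbound (mul (star a) a) M ->
  opbound a (Num.sqrt M).
Proof.
move=> ha M0 H x r s xi eta ur us.
set t := Num.sqrt M; have t0 : 0 < t by rewrite sqrtr_gt0.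
have t2 : t ^+ 2 = M by rewrite sqr_sqrtr // ltW.
pose z := orbact a x s xi.
have hz : sqnorm r z <= M * sqnorm s xi.
  have [L0 rL] := sub_rng r.
  have hc := @cvg_orbform_mul (star a) a x s s xi xi (L1_star ha) ha.
  have eq L : cabs (orbform (star a) x s (rng L) z xi) = sqnorm (rng L) z.
    by rewrite orbform_star cabsJ orbform_act_self cabs_cofr // sqnorm_ge0.
  have hc' : (fun L => sqnorm (rng L) z) @ \oo --> cabs (orbform (mul (star a) a) x s s xi xi).
    rewrite (_ : (fun L => _) = fun L => cabs (orbform (star a) x s (rng L) z xi)).
      by apply: cvg_cabs; exact: hc.
    by apply/funext => L; rewrite eq.
  apply: (@le_trans _ _ (sqnorm (rng L0) z)); first by apply: sqnorm_sub => //; exact: rng_uniq.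
  apply: (@le_trans _ _ (cabs (orbform (mul (star a) a) x s s xi xi))); last first.
    apply: le_trans (H x s s xi xi us us) _.
    by rewrite (_ : M / 2 * _ = M * sqnorm s xi) //; field.
  rewrite -(cvg_lim _ hc') //; apply: limr_ge; first exact: cvgP hc'.
  near=> L; apply: sqnorm_sub; try exact: rng_uniq.
  by apply: rng_sub; near: L; exists L0.
rewrite orbform_act -/z; apply: le_trans (cabs_sum _ _) _.
apply: (@le_trans _ _ (\sum_(m <- r) 2^-1 * (t * cabs (eta m) ^+ 2 + t^-1 * cabs (z m) ^+ 2))).
  by apply: ler_sum => m _; rewrite cabsM cabsJ; exact: amgm.
rewrite -mulr_sumr big_split /= -!mulr_sumr -/(sqnorm r eta) -/(sqnorm r z).
rewrite (_ : t / 2 * _ = 2^-1 * (t * sqnorm r eta + t * sqnorm s xi)); last by ring.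
rewrite ler_wpM2l ?invr_ge0 // lerD2l mulrC ler_pdivrMr //.
by rewrite mulrAC -expr2 t2.
Unshelve. all: by end_near. Qed.

Lemma le_mul_addgt0 (x y z : R) : 0 <= y -> 0 <= z ->
  (forall e, 0 < e -> x <= (y + e) * (z + e)) -> x <= y * z.
Proof.
move=> y0 z0 H; apply/ler_addgt0Pr => d d0.
(* The excess [e * (y + z + e)] of the product is at most [e * (y + z + 1)], hence at most [d]. *)
pose e := Num.min 1 (d / (y + z + 1)).
have s0 : 0 < y + z + 1 by rewrite ltr_wpDl // addr_ge0.
have e0 : 0 < e by rewrite lt_min ltr01 divr_gt0.
have e1 : e <= 1 by rewrite ge_min lexx.
have e2 : e * (y + z + 1) <= d by rewrite -ler_pdivlMr // ge_min lexx orbT.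
apply: le_trans (H e e0) _; move: e0 e1 e2; move: e => e e0 e1 e2; nra.
Qed.

Lemma regnorm_star a : l1elt a -> regnorm (star a) <= regnorm a.
Proof.
move=> ha; apply: regnorm_le (regnorm_ge0 a) _ => e e0.
exact/opbound_star/regnorm_opbound.
Qed.

Lemma regnorm_add a b : l1elt a -> l1elt b -> regnorm (Ladd a b) <= regnorm a + regnorm b.
Proof.
move=> ha hb; apply: regnorm_le; first by rewrite addr_ge0 ?regnorm_ge0.
move=> e e0; have e2 : 0 < e / 2 by rewrite divr_gt0.
have := opbound_add (regnorm_opbound ha e2) (regnorm_opbound hb e2).
by apply: opbound_le; rewrite addrACA -splitr.
Qed.

Lemma regnorm_scale_le (z : C) a : l1elt a -> regnorm (Lscale z a) <= cabs z * regnorm a.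
Proof.
move=> ha; apply: regnorm_le; first by rewrite mulr_ge0 ?regnorm_ge0 ?cabs_ge0.
move=> e e0; have z1 : 0 < cabs z + 1 by rewrite ltr_wpDl // cabs_ge0.
have := opbound_scale z (regnorm_opbound ha (divr_gt0 e0 z1)).
apply: opbound_le; rewrite mulrDr lerD2l mulrCA; apply: ler_piMr; first exact: ltW.
by rewrite ler_pdivrMr // mul1r lerDl.
Qed.

Lemma regnorm_mul a b : l1elt a -> l1elt b -> regnorm (mul a b) <= regnorm a * regnorm b.
Proof.
move=> ha hb; apply: le_mul_addgt0; rewrite ?regnorm_ge0 // => e e0.
have a0 := regnorm_ge0 a; have b0 := regnorm_ge0 b.
apply: regnorm_le => [|d d0]; first by rewrite mulr_ge0 ?addr_ge0 // ltW.
have b1 : 0 < regnorm b + e by rewrite ltr_wpDl.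
have a1 : 0 <= regnorm a + e by rewrite addr_ge0 // ltW.
have := opbound_mul ha hb b1 (regnorm_opbound ha e0) a1 (regnorm_opbound hb e0).
by apply: opbound_le; rewrite lerDl ltW.
Qed.

Lemma regnorm_cstar a : l1elt a -> regnorm (mul (star a) a) = regnorm a ^+ 2.
Proof.
move=> ha; have saL : l1elt (mul (star a) a) by l1.
apply/eqP; rewrite eq_le; apply/andP; split.
  apply: le_trans (regnorm_mul (L1_star ha) ha) _.
  by rewrite expr2 ler_wpM2r ?regnorm_ge0 // regnorm_star.
apply/ler_addgt0Pr => e e0.
set M := regnorm (mul (star a) a) + e.
have M0 : 0 < M by rewrite ltr_wpDl // regnorm_ge0.
have : regnorm a <= Num.sqrt M.
  apply: regnorm_le => [|d d0]; first exact: sqrtr_ge0.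
  have := opbound_sqrt ha M0 (regnorm_opbound saL e0).
  by apply: opbound_le; rewrite lerDl ltW.
move=> H; rewrite -(sqr_sqrtr (ltW M0)) ler_pXn2r ?nnegrE ?regnorm_ge0 //.
Qed.

Lemma regnorm_scale (z : C) a : l1elt a -> regnorm (Lscale z a) = cabs z * regnorm a.
Proof.
move=> ha; apply/eqP; rewrite eq_le regnorm_scale_le //=.
have [->|z0] := eqVneq z 0; first by rewrite cabs0 mul0r regnorm_ge0.
have zz : cabs z * cabs z^-1 = 1 by rewrite -cabsM divff // cabs1.
have zaL : l1elt (Lscale z a) by l1.
have := regnorm_scale_le z^-1 zaL.
rewrite (_ : Lscale z^-1 (Lscale z a) = a); last first.
  by apply: Lelt_eq => k x; rewrite /Lscale mulrA mulVf // mul1r.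
by move=> /(ler_wpM2l (cabs_ge0 z)); rewrite mulrA zz mul1r.
Qed.

Lemma regnorm_seminorm (S : set (Lelt R X)) : (forall a, S a -> l1elt a) ->
  cstar_seminorm sigma sigmainv S regnorm.
Proof.
move=> SL; split=> [a _|a b /SL ha /SL hb|z a /SL ha|a b /SL ha /SL hb|a /SL ha].
- exact: regnorm_ge0.
- exact: regnorm_add.
- exact: regnorm_scale.
- exact: regnorm_mul.
- exact: regnorm_cstar.
Qed.

End RegularNorm.

(** * Domination of C*-seminorms by the regular norm *)

Lemma mem_rngE k N : (k \in rng N) = (- N%:Z <= k) && (k < N%:Z).
Proof. by rewrite mem_rng; case: k => k; lia. Qed.

Lemma bernoulli (d : R) n : 0 <= d -> 1 + n%:R * d <= (1 + d) ^+ n.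
Proof.
move=> d0; elim: n => [|n IH]; first by rewrite mul0r addr0 expr0.
rewrite exprS; apply: le_trans (ler_wpM2l _ IH); last by rewrite addr_ge0.
have n0 : 0 <= n%:R :> R by rewrite ler0n.
rewrite -natr1; move: (n%:R) n0 => t t0; nra.
Qed.

(* Polynomial factors disappear in the limit of [2^m]-th roots. *)
Lemma le_of_pow2_growth (x y c : R) : 0 <= x -> 0 <= y -> 0 <= c ->
  (forall m, x ^+ (2 ^ m) <= c * (2 ^ m)%:R * y ^+ (2 ^ m)) -> x <= y.
Proof.
move=> x0 y0 c0 H; rewrite leNgt; apply/negP => yx.
have [y00|yn0] := eqVneq y 0.
  by have := H 0%N; rewrite expn0 !expr1 y00 mulr0 leNgt -y00 yx.
have yp : 0 < y by rewrite lt_def yn0.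
pose d := x / y - 1.
have d0 : 0 < d by rewrite subr_gt0 ltr_pdivlMr // mul1r.
have xE : x = y * (1 + d) by rewrite /d addrC subrK mulrC divfK.
(* The square of the Bernoulli inequality at half the exponent grows quadratically in 2^k and so
   contradicts the linear factor; the inequality at the full exponent would only be linear. *)
have key k : (2 ^ k)%:R * d ^+ 2 <= 2 * c.
  have := H k.+1; rewrite xE exprMn mulrC ler_pM2r ?exprn_gt0 //.
  rewrite expnS mulnC exprM; set n := (2 ^ k)%N.
  have n0 : 0 < n%:R :> R by rewrite ltr0n expn_gt0.
  have := @bernoulli d n (ltW d0).
  rewrite natrM; move: (n%:R) n0 ((1 + d) ^+ n) => t t0 w hw hc.
  have : (t * d) ^+ 2 <= w ^+ 2.
    by rewrite ler_pXn2r ?nnegrE //; [lra | apply: mulr_ge0; lra | apply: le_trans hw; nra].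
  rewrite exprMn => h; have : t * (t * d ^+ 2) <= t * (2 * c) by rewrite mulrA -expr2; lra.
  by rewrite ler_pM2l.
have := key (Num.truncn (2 * c / d ^+ 2)).+1.
have d2 : 0 < d ^+ 2 by rewrite exprn_gt0.
rewrite -ler_pdivlMr // leNgt => /negP; apply.
apply: (lt_le_trans (truncnS_gt _)).
by rewrite ler_nat ltnW // ltn_expl.
Qed.

Definition supp_in (d : nat) a := forall k x, k \notin rng d -> a k x = 0.

Lemma supp_restr d a : supp_in d (Lrestr (rng d) a).
Proof. by move=> k x kd; rewrite /Lrestr (negbTE kd). Qed.

(** The reflected interval ]-d, d] lies in [rng d.+1] but not in [rng d]. *)
Lemma supp_star d a : supp_in d a -> supp_in d.+1 (star a).
Proof.
move=> H k x kd; rewrite /Lstar /alphapow /= H ?rmorph0 //.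
by move: kd; rewrite !mem_rngE; lia.
Qed.

Lemma supp_mul d d' a b : supp_in d a -> supp_in d' b -> supp_in (d + d') (mul a b).
Proof.
move=> H H' n x nd; rewrite /Lmul (@zsum_fin _ _ [::]) ?big_nil // => k _.
have [kd|kd] := boolP (k \in rng d); last by rewrite H // mul0r.
rewrite /alphapow /= H' ?mulr0 //.
by move: nd kd; rewrite !mem_rngE; lia.
Qed.

(** The factor [d.*2] is the number of indices in [rng d]. *)
Lemma zbound_supp d a (M : R) : (forall k x, cabs (a k x) <= M) -> supp_in d a ->
  zbound (fun k => supnorm (a k)) (M *+ d.*2).
Proof.
move=> hM ha r ur.
have M0 : 0 <= M by case: Xne => x _; exact: le_trans (cabs_ge0 _) (hM 0 x).
apply: (@le_trans _ _ (\sum_(k <- r) if k \in rng d then M else 0)).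
  apply: ler_sum => k _; case: ifPn => kd; first exact: supnorm_le.
  by apply: supnorm_le => // x; rewrite ha // cabs0.
rewrite -big_mkcond /= -big_filter big_const_seq count_predT iter_addr_0.
apply: ler_wpMn2l => //; rewrite -size_rng; apply: uniq_leq_size; first exact: filter_uniq.
move=> k.
by rewrite mem_filter => /andP[].
Qed.

Section Comparison.
Variables (S : set (Lelt R X)) (p : Lelt R X -> R).
Hypothesis gS : good_subalgebra S.
Hypothesis hp : cstar_seminorm sigma sigmainv S p.

Lemma seminorm_finsupp h d : S h -> star h = h -> supp_in d h -> p h <= regnorm h.
Proof.
move=> hS hs hd; have hL := good_L1 gS hS; case: (hp) => p0 _ _ _ pS.
(* Repeated squaring keeps the element self-adjoint, so the C*-identity squares both [p] and
   [regnorm] at each stage, while the support only doubles. *)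
pose hm m := iter m (fun a => mul a a) h.
have hmP m : [/\ S (hm m), star (hm m) = hm m & supp_in (d * 2 ^ m) (hm m)].
  elim: m => [|m [mS ms md]]; first by rewrite expn0 muln1.
  have mL := good_L1 gS mS; rewrite /hm iterS -/(hm m); split.
  - exact: (good_mul gS).
  - by rewrite (starM mL mL) ms.
  - by rewrite expnS mulnCA mul2n -addnn; exact: supp_mul.
have pm m : p (hm m) = p h ^+ (2 ^ m).
  elim: m => [|m IH]; first by rewrite expn0 expr1.
  have [mS ms _] := hmP m.
  by rewrite /hm iterS -/(hm m) -{1}ms pS // IH -exprM mulnC -expnS.
have qm m : regnorm (hm m) = regnorm h ^+ (2 ^ m).
  elim: m => [|m IH]; first by rewrite expn0 expr1.
  have [mS ms _] := hmP m; have mL := good_L1 gS mS.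
  by rewrite /hm iterS -/(hm m) -{1}ms regnorm_cstar // IH -exprM mulnC -expnS.
apply: (@le_of_pow2_growth _ _ (d.*2)%:R); rewrite ?p0 ?regnorm_ge0 ?ler0n // => m.
have [mS ms md] := hmP m; have mL := good_L1 gS mS.
rewrite -pm -qm; apply: le_trans (seminorm_le_N1 gS hp mS) _.
apply: le_trans (N1_le (zbound_supp (fun k x => regnorm_entry k x mL) md)) _.
by rewrite -natrM -doubleMl mulr_natl.
Qed.

Lemma seminorm_le_regnorm a : S a -> p a <= regnorm a.
Proof.
move=> aS; have aL := good_L1 gS aS; case: (hp) => p0 pD pZ _ pS.
apply/ler_addgt0Pr => e e0; have e2 : 0 < e / 2 by rewrite divr_gt0.
have [K HK] := restr_approx aL e2.
set b := Lrestr (rng K) a in HK.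
have bS : S b by exact: (good_restr gS).
have bL := good_L1 gS bS.
have abS : S (Lsub a b) by rewrite /Lsub LoppE; apply: (good_add gS) => //; exact: (good_scale gS).
have abL := good_L1 gS abS.
(* The truncation [b] need not be self-adjoint, but b^* b is, and its support is still finite. *)
have pb : p b <= regnorm b.
  rewrite -(@ler_pXn2r _ 2) ?nnegrE ?p0 ?regnorm_ge0 // -pS // -regnorm_cstar //.
  apply: (@seminorm_finsupp _ (K.+1 + K)).
  - by apply: (good_mul gS) => //; exact: (good_star gS).
  - by rewrite starM ?starK //; exact: L1_star.
  - by apply: supp_mul; [apply: supp_star|]; exact: supp_restr.
have E : a = Ladd b (Lsub a b).
  by apply: Lelt_eq => k x; rewrite /Ladd /Lsub /Ladd /Lopp addrC subrK.
have E' : b = Ladd a (Lsub b a).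
  by apply: Lelt_eq => k x; rewrite /Ladd /Lsub /Ladd /Lopp addrC subrK.
have baL : l1elt (Lsub b a) by l1.
have h1 : p a <= p b + p (Lsub a b) by rewrite {1}E; exact: pD.
have h2 := le_trans (seminorm_le_N1 gS hp abS) HK.
have h3 : regnorm b <= regnorm a + regnorm (Lsub b a) by rewrite {1}E'; exact: regnorm_add.
have h4 : regnorm (Lsub b a) <= e / 2.
  by apply: le_trans (regnorm_le_N1 baL) _; rewrite N1_subC.
apply: le_trans h1 _; apply: le_trans (lerD (le_trans pb h3) h2) _.
by rewrite -addrA lerD2l [leRHS]splitr lerD2r.
Qed.

End Comparison.

(** [regnorm] is itself a C*-seminorm on [S] and dominates all the others, so the supremum is a
    maximum. *)
Lemma envnorm_good (S : set (Lelt R X)) a : good_subalgebra S -> S a ->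
  envnorm sigma sigmainv S a = regnorm a.
Proof.
move=> gS aS; apply/eqP; rewrite eq_le; apply/andP; split.
  apply: ge_sup; first by exists (regnorm a), regnorm => //; exact: regnorm_seminorm (good_L1 gS).
  by move=> _ [p hp <-]; exact: seminorm_le_regnorm gS hp _ aS.
apply: ub_le_sup; last by exists regnorm => //; exact: regnorm_seminorm (good_L1 gS).
by exists (regnorm a) => _ [p hp <-]; exact: seminorm_le_regnorm gS hp _ aS.
Qed.

Lemma l1eltP a : l1elt a <-> L1 a.
Proof. by split=> [[]|]. Qed.

Lemma good_L1alg : good_subalgebra (@L1 R X).
Proof.
split=> [a|||||||a /l1eltP //].
- exact: L1elt.
- exact/l1eltP/L1_one.
- by move=> a b /l1eltP ha /l1eltP hb; apply/l1eltP/L1_add.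
- by move=> z a /l1eltP ha; apply/l1eltP/L1_scale.
- by move=> a b /l1eltP ha /l1eltP hb; apply/l1eltP/L1_mul.
- by move=> a /l1eltP ha; apply/l1eltP/L1_star.
- by move=> r a /l1eltP ha; apply/l1eltP/L1_restr.
Qed.

(** In this form the condition decouples the coefficients, so truncation and Fejer means, which only
    rescale them one by one, preserve it. *)
Lemma commutant1P a : commutant1 sigma sigmainv a <->
  l1elt a /\ forall f : X -> C, contC f -> forall n x, a n x * f (sp (- n) x) = f x * a n x.
Proof.
split=> [[/L1elt aL H]|[aL H]].
  by split=> // f hf n x; rewrite -mul_embr H // mul_embl.
split; first exact/l1eltP.
by move=> f hf; apply: Lelt_eq => n x; rewrite mul_embr mul_embl H.
Qed.

Lemma good_commutant1 : good_subalgebra (commutant1 sigma sigmainv).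
Proof.
split.
- by move=> a /commutant1P[].
- split; first exact/l1eltP/L1_one.
  by move=> f _; rewrite mul1L mulL1.
- move=> a b /commutant1P[aL ha] /commutant1P[bL hb]; apply/commutant1P; split; first by l1.
  by move=> f hf n x; rewrite /Ladd mulrDl mulrDr ha // hb.
- move=> z a /commutant1P[aL ha]; apply/commutant1P; split; first by l1.
  by move=> f hf n x; rewrite /Lscale -mulrA ha // mulrCA.
- move=> a b [/l1eltP aL ha] [/l1eltP bL hb]; split; first by apply/l1eltP; l1.
  move=> f hf; have fL := L1_emb hf.
  by rewrite (mulLA aL bL fL) hb // -(mulLA aL fL bL) ha // (mulLA fL aL bL).
- move=> a [/l1eltP aL ha]; split; first by apply/l1eltP; l1.
  move=> f hf; have gc := contCJ hf; have gL := L1_emb gc.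
  have E : star (Lemb (fun x => (f x)^*)) = Lemb f.
    by rewrite star_emb; congr Lemb; apply/funext => x; rewrite conjCK.
  by rewrite -E -(starM gL aL) -(starM aL gL) ha.
- move=> r a /commutant1P[aL ha]; apply/commutant1P; split; first by l1.
  by move=> f hf n x; rewrite /Lrestr; case: (n \in r); rewrite ?ha // mul0r mulr0.
- move=> a aL H; apply/commutant1P; split=> // f hf n x.
  apply/eqP; rewrite -subr_eq0; apply/eqP; apply: cabs_eq0; apply/eqP.
  rewrite eq_le cabs_ge0 andbT; apply/ler_addgt0Pr => e e0; rewrite add0r.
  set c := cabs (f (sp (- n) x) - f x).
  have c1 : 0 < c + 1 by rewrite ltr_wpDl // cabs_ge0.
  have [b /commutant1P[bL hb] hN] := H _ (divr_gt0 e0 c1).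
  (* The contribution of [b] vanishes because [b] lies in the commutant, so only the small
     difference from [a] remains. *)
  have -> : a n x * f (sp (- n) x) - f x * a n x =
      Lsub a b n x * (f (sp (- n) x) - f x).
    have := hb f hf n x; rewrite /Lsub /Ladd /Lopp => E.
    by rewrite mulrBr !mulrDl !mulNr E; ring.
  have abL : l1elt (Lsub a b) by l1.
  rewrite cabsM -/c; apply: le_trans (ler_wpM2r (cabs_ge0 _) (cabs_N1 n x abL)) _.
  apply: le_trans (ler_wpM2r (cabs_ge0 _) hN) _.
  by rewrite mulrAC ler_pdivrMr // ler_pM2l // lerDl.
Qed.

Lemma cstarnormE a : l1elt a -> cstarnorm sigma sigmainv a = regnorm a.
Proof. by move=> /l1eltP aL; apply: envnorm_good good_L1alg aL. Qed.

(** * Fejer summation *)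

Definition window (N : nat) (k : int) : bool := (0 <= k) && (k < N.+1%:Z).

(** This is the usual weight 1 - |n| / (N + 1), cut off at 0, written as the normalised overlap of a
    window with its translate by [n]; the estimate of the Schur multiplier uses this form. *)
Definition fejer_weight (N : nat) (n : int) : R :=
  N.+1%:R^-1 * \sum_(0 <= i < N.+1) (window N (i%:Z - n))%:R.

Definition fejer N a : Lelt R X := fun n x => cofr (fejer_weight N n) * a n x.

Lemma fejer_weight_ge0 N n : 0 <= fejer_weight N n.
Proof. by rewrite mulr_ge0 ?invr_ge0 ?sumr_ge0 // => i _; rewrite ler0n. Qed.

Lemma fejer_weight_le1 N n : fejer_weight N n <= 1.
Proof.
rewrite /fejer_weight mulrC ler_pdivrMr ?ltr0Sn // mul1r.
apply: (@le_trans _ _ (\sum_(0 <= i < N.+1) 1)).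
  by apply: ler_sum => i _; rewrite lern1 leq_b1.
by rewrite big_const_nat iter_addr_0 subn0.
Qed.

Lemma fejer_weight_supp N n : n \notin rng N.+1 -> fejer_weight N n = 0.
Proof.
rewrite mem_rngE => hn; rewrite /fejer_weight big_nat big1 ?mulr0 // => i iN.
by rewrite (_ : window _ _ = false) //; move: hn iN; rewrite /window; lia.
Qed.

Lemma sum_lt_indicator M e : \sum_(0 <= i < M) (i < e)%N%:R = (minn M e)%:R :> R.
Proof.
elim: M => [|M IH]; first by rewrite big_geq // min0n.
by rewrite big_nat_recr //= IH -natrD; congr (_%:R); lia.
Qed.

Lemma fejer_weight_defect N n : 1 - fejer_weight N n <= `|n|%N%:R / N.+1%:R.
Proof.
have N0 : 0 < N.+1%:R :> R by rewrite ltr0Sn.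
rewrite ler_pdivlMr // mulrBl mul1r /fejer_weight [_^-1 * _]mulrC divfK ?gt_eqF //.
have -> : N.+1%:R = \sum_(0 <= i < N.+1) 1 :> R by rewrite big_const_nat iter_addr_0 subn0.
rewrite -sumrB.
apply: (@le_trans _ _ (\sum_(0 <= i < N.+1) (i < `|n|)%N%:R)); last first.
  by rewrite sum_lt_indicator ler_nat geq_minr.
have E (b : bool) : 1 - b%:R = (~~ b)%:R :> R by case: b; rewrite ?subrr ?subr0.
have [n0|n0] := leP 0 n.
  rewrite le_eqVlt; apply/orP; left; apply/eqP; rewrite !big_nat; apply: eq_bigr => i iN.
  by rewrite E; congr (nat_of_bool _)%:R; rewrite /window; lia.
(* For negative [n] it is the last |n| indices that leave the window; reversing the sum makes them
   the first ones. *)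
rewrite [leLHS]big_nat_rev /= add0n.
rewrite le_eqVlt; apply/orP; left; apply/eqP; rewrite !big_nat; apply: eq_bigr => i iN.
by rewrite E; congr (nat_of_bool _)%:R; rewrite /window; lia.
Qed.

Lemma L1_fejer N a : l1elt a -> l1elt (fejer N a).
Proof.
move=> aL; apply: (@L1_intro _ (N1 a)) => [k|].
  by apply: contCM; [exact: contC_cst | exact: L1_cont].
apply: zbound_le (L1_bound aL) => k; apply: supnorm_le => // x.
rewrite cabsM cabs_cofr ?fejer_weight_ge0 //.
apply: le_trans (cabs_supnorm k x aL).
by rewrite ler_piMl ?cabs_ge0 ?fejer_weight_le1.
Qed.

Lemma sum_window N m (J : seq int) (F : int -> R) : uniq J ->
  {subset [seq m - i%:Z | i <- iota 0 N.+1] <= J} ->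
  (forall j, ~~ window N (m - j) -> F j = 0) ->
  \sum_(j <- J) F j = \sum_(0 <= i < N.+1) F (m - i%:Z).
Proof.
move=> uJ hJ hF.
have ui : uniq [seq m - i%:Z | i <- iota 0 N.+1].
  by rewrite map_inj_uniq ?iota_uniq // => i j /addrI /oppr_inj [].
rewrite (sum_sub_split F ui uJ hJ) [X in _ + X]big1 ?addr0.
  by rewrite big_map /index_iota subn0.
move=> j jn; apply: hF; apply: contra jn; rewrite /window => /andP[h0 h1].
apply/mapP; exists `|m - j|%N; last by lia.
by rewrite mem_iota; lia.
Qed.

(* [fejer_weight N (m - k)] averages, over the translates of a window of length [N.+1], the
   event that both [m] and [k] lie in it; hence it is a contractive Schur multiplier. *)
Lemma opbound_fejer N a (M : R) : 0 <= M -> opbound a M -> opbound (fejer N a) M.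
Proof.
move=> M0 H x r s xi eta ur us.
have [K HK] := sub_rng [seq m - i%:Z | m <- r ++ s, i <- iota 0 N.+1].
have hK m : m \in r ++ s -> {subset [seq m - i%:Z | i <- iota 0 N.+1] <= rng K}.
  move=> mr j /mapP[i hi ->]; apply: HK; apply/allpairsP.
  by exists (m, i).
(* [w j m] indicates that [m] lies in [j, j + N]; [rng K] contains every such [j] for the points [m]
   of [r] and [s]. *)
pose w j m : R := (window N (m - j))%:R.
have w2 j m : w j m ^+ 2 = w j m by rewrite /w; case: (window _ _); rewrite ?expr1n ?expr0n.
have w0 j m : 0 <= w j m by rewrite ler0n.
have wE m k : m \in r -> fejer_weight N (m - k) = N.+1%:R^-1 * \sum_(j <- rng K) w j m * w j k.
  move=> mr; congr (_ * _).
  rewrite (@sum_window N m _ (fun j => w j m * w j k) (rng_uniq K)); first last.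
  - by move=> j hj; rewrite /w (negbTE hj) mul0r.
  - by apply: hK; rewrite mem_cat mr.
  rewrite !big_nat; apply: eq_bigr => i /andP[_ iN]; rewrite /w.
  rewrite (_ : window N (m - (m - i%:Z)) = true); last by rewrite /window; lia.
  by rewrite mul1r; congr (window _ _)%:R; lia.
have wS m : m \in r ++ s -> \sum_(j <- rng K) w j m = N.+1%:R.
  move=> mr; rewrite (@sum_window N m _ (fun j => w j m) (rng_uniq K)); first last.
  - by move=> j hj; rewrite /w (negbTE hj).
  - exact: hK.
  rewrite big_nat (eq_bigr (fun=> 1)); last first.
    by move=> i /andP[_ iN]; rewrite /w (_ : window _ _ = true) // /window; lia.
  by rewrite -big_nat big_const_nat iter_addr_0 subn0.
(* Each point lies in exactly [N.+1] windows, so the squared norms of the pieces add up to [N.+1]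
   times the whole, which the averaging factor cancels. *)
have sqw q zeta : {subset q <= r ++ s} ->
    \sum_(j <- rng K) sqnorm q (fun k => cofr (w j k) * zeta k) = N.+1%:R * sqnorm q zeta.
  move=> qs; rewrite /sqnorm exchange_big /= mulr_sumr big_seq [RHS]big_seq.
  apply: eq_bigr => k kq; rewrite -(wS k (qs k kq)) mulr_suml.
  by apply: eq_bigr => j _; rewrite cabsM cabs_cofr // exprMn w2.
have N0 : 0 < N.+1%:R :> R by rewrite ltr0Sn.
have -> : orbform (fejer N a) x r s xi eta = cofr N.+1%:R^-1 * \sum_(j <- rng K)
    orbform a x r s (fun k => cofr (w j k) * xi k) (fun m => cofr (w j m) * eta m).
  rewrite mulr_sumr /orbform.
  under [RHS]eq_bigr do rewrite mulr_sumr.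
  rewrite [RHS]exchange_big /= big_seq [RHS]big_seq; apply: eq_bigr => m mr.
  under [RHS]eq_bigr do rewrite mulr_sumr.
  rewrite [RHS]exchange_big /=; apply: eq_bigr => k _.
  rewrite /fejer (wE m k mr) cofrM.
  rewrite (_ : cofr (\sum_(j <- rng K) w j m * w j k) =
               \sum_(j <- rng K) cofr (w j m) * cofr (w j k)); last first.
    elim: (rng K) => [|j q IH]; first by rewrite !big_nil.
    by rewrite !big_cons cofrD IH cofrM.
  rewrite mulr_sumr !mulr_suml mulr_sumr mulr_suml; apply: eq_bigr => j _.
  by rewrite rmorphM /= cofr_conj; ring.
rewrite cabsM cabs_cofr ?invr_ge0 ?ler0n //.
rewrite mulrC ler_pdivrMr //; apply: le_trans (cabs_sum _ _) _.
apply: (@le_trans _ _ (\sum_(j <- rng K) M / 2 *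
   (sqnorm r (fun m => cofr (w j m) * eta m) + sqnorm s (fun k => cofr (w j k) * xi k)))).
  by apply: ler_sum => j _; exact: H.
rewrite -mulr_sumr big_split /= !sqw.
- by rewrite -mulrDr mulrCA [N.+1%:R * _]mulrC.
- by move=> k ks; rewrite mem_cat ks orbT.
- by move=> k kr; rewrite mem_cat kr.
Qed.

Lemma regnorm_fejer N a : l1elt a -> regnorm (fejer N a) <= regnorm a.
Proof.
move=> aL; apply: regnorm_le (regnorm_ge0 a) _ => e e0.
by apply: opbound_fejer (regnorm_opbound aL e0); rewrite addr_ge0 ?regnorm_ge0 ?ltW.
Qed.

Lemma fejer_approx a (e : R) : l1elt a -> 0 < e -> exists N, N1 (Lsub a (fejer N a)) <= e.
Proof.
move=> aL e0; have e2 : 0 < e / 2 by rewrite divr_gt0.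
have [K HK] := zbound_tail (fun k => supnorm_ge0 Xcpt Xne (L1_cont aL k)) (L1_bound aL) e2.
(* On [rng K] the weights differ from 1 by at most K / (N + 1); since N + 1 exceeds [t], this costs
   at most [e / 2]. The tail outside [rng K] costs the other half. *)
pose t := K%:R * N1 a / (e / 2).
exists (Num.truncn t); set N := Num.truncn t.
have N0 : 0 < N.+1%:R :> R by rewrite ltr0Sn.
have c0 : 0 <= K%:R / N.+1%:R :> R by rewrite divr_ge0 ?ler0n.
have B1 : zbound (fun k => K%:R / N.+1%:R * supnorm (a k)) (e / 2).
  move=> r ur; apply: le_trans (zboundZ c0 (L1_bound aL) ur) _.
  rewrite mulrAC ler_pdivrMr // [leRHS]mulrC -ler_pdivrMr //; apply/ltW.
  exact: truncnS_gt.
apply: N1_le; rewrite [e]splitr; apply: zbound_le (zboundD B1 HK) => k.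
apply: supnorm_le => // x.
have s0 : 0 <= supnorm (a k) by apply: supnorm_ge0 => //; exact: L1_cont.
have w1 : 0 <= 1 - fejer_weight N k by rewrite subr_ge0 fejer_weight_le1.
rewrite (_ : Lsub a (fejer N a) k x = cofr (1 - fejer_weight N k) * a k x); last first.
  have -> : cofr (1 - fejer_weight N k) = 1 - cofr (fejer_weight N k).
    by apply/eqP; rewrite eq_sym subr_eq -cofrD subrK.
  by rewrite mulrBl mul1r.
rewrite cabsM cabs_cofr //; case: ifPn => kK.
  rewrite addr0; apply: ler_pM; rewrite ?cabs_ge0 ?cabs_supnorm //.
  apply: le_trans (fejer_weight_defect N k) _; rewrite ler_wpM2r ?invr_ge0 ?ler0n // ler_nat.
  by move: kK; rewrite mem_rngE; lia.
apply: (@le_trans _ _ (cabs (a k x))).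
  by rewrite ler_piMl ?cabs_ge0 // lerBlDr lerDl fejer_weight_ge0.
by rewrite (le_trans (cabs_supnorm k x aL)) // lerDr mulr_ge0.
Qed.

Lemma fejerB N a b : fejer N (Lsub a b) = Lsub (fejer N a) (fejer N b).
Proof. by apply: Lelt_eq => k x; rewrite /fejer /Lsub /Ladd /Lopp mulrBr. Qed.

Lemma regnorm_tri b a c : l1elt a -> l1elt b -> l1elt c ->
  regnorm (Lsub a c) <= regnorm (Lsub a b) + regnorm (Lsub b c).
Proof.
move=> aL bL cL; rewrite (_ : Lsub a c = Ladd (Lsub a b) (Lsub b c)).
  by apply: regnorm_add; l1.
by apply: Lelt_eq => k x; rewrite /Lsub /Ladd /Lopp addrA subrK.
Qed.

(** * Approximation of elements commuting with C(X) *)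

Section Density.
Variable u : nat -> Lelt R X.
Hypothesis uL : forall n, l1elt (u n).
Hypothesis ucauchy : forall e : R, 0 < e -> exists N : nat, forall m n,
  (N <= m)%N -> (N <= n)%N -> regnorm (Lsub (u m) (u n)) < e.
Hypothesis ucomm : forall f : X -> C, contC f ->
  (fun n => regnorm (Lsub (mul (u n) (Lemb f)) (mul (Lemb f) (u n)))) @ \oo --> (0 : R).

(** The coefficients are dominated by [regnorm], so they converge uniformly in [k] and [x]. The
    limit [c] is the family of Fourier coefficients of the element represented by [u]; it need not
    lie in [L1]. *)
Lemma fourier_limit : exists c : Lelt R X,
  forall e : R, 0 < e -> exists N : nat, forall n, (N <= n)%N ->
    forall k x, cabs (u n k x - c k x) <= e.
Proof.
have hex (kx : int * X) : exists z : C, (fun n => u n kx.1 kx.2) @ \oo --> z.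
  case: kx => k x /=; apply: cplx_cauchy_cvg => e e0.
  have [N HN] := ucauchy e0; exists N => m n Nm Nn.
  exact: le_lt_trans (regnorm_entry k x (L1_sub (uL m) (uL n))) (HN m n Nm Nn).
have [l hl] := choice hex.
exists (fun k x => l (k, x)) => e e0; have [N HN] := ucauchy e0.
exists N => n Nn k x.
have hc : (fun m => u n k x - u (m + N)%N k x) @ \oo --> u n k x - l (k, x).
  apply: cvgB; first exact: cvg_cst.
  by have := hl (k, x); rewrite -(cvg_shiftn N).
apply: cabs_cvg_le hc _ => m.
apply: le_trans (regnorm_entry k x (L1_sub (uL n) (uL (m + N)))) _.
by apply/ltW/HN => //; exact: leq_addl.
Qed.

Variable c : Lelt R X.
Hypothesis hc : forall e : R, 0 < e -> exists N : nat, forall n, (N <= n)%N ->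
  forall k x, cabs (u n k x - c k x) <= e.

Lemma fourier_limit_cont k : contC (c k).
Proof.
apply: contC_unif => e e0; have [N HN] := hc e0.
by exists (u N k); [exact: L1_cont | exact: HN].
Qed.

Lemma fourier_limit_comm (f : X -> C) k x : contC f -> c k x * f (sp (- k) x) = f x * c k x.
Proof.
move=> hf; apply/eqP; rewrite -subr_eq0; apply/eqP; apply: cabs_eq0; apply/eqP.
rewrite eq_le cabs_ge0 andbT; apply/ler_addgt0Pr => e e0; rewrite add0r.
set d := f (sp (- k) x) - f x.
have d1 : 0 < cabs d + 1 by rewrite ltr_wpDl // cabs_ge0.
have e2 : 0 < e / 2 by rewrite divr_gt0.
have [N HN] := hc (divr_gt0 e2 d1).
have /cvgrPdist_lt /(_ _ e2) [M _ HM] := ucomm hf.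
have := HM (maxn N M) (leq_maxr _ _); have := HN (maxn N M) (leq_maxl _ _) k x.
move: (maxn N M) => n hn /=; rewrite sub0r normrN ger0_norm ?regnorm_ge0 // => hr.
have fL := L1_emb hf; have unL := uL n.
have DL : l1elt (Lsub (mul (u n) (Lemb f)) (mul (Lemb f) (u n))) by l1.
have h1 := le_lt_trans (regnorm_entry k x DL) hr.
(* The second summand is the coefficient at [k] of the commutator of [u n] with [f], which [regnorm]
   controls. *)
rewrite (_ : c k x * _ - _ = - ((u n k x - c k x) * d) +
   (u n k x * f (sp (- k) x) - f x * u n k x)); last by rewrite /d; ring.
apply: le_trans (cabsD _ _) _; rewrite [e]splitr lerD //.
  rewrite cabsN cabsM; apply: le_trans (ler_wpM2r (cabs_ge0 _) hn) _.
  by rewrite mulrAC ler_pdivrMr // ler_pM2l // lerDl.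
by move: h1; rewrite /Lsub /Ladd /Lopp mul_embr mul_embl => /ltW.
Qed.

Lemma fejer_supp N a : supp_in N.+1 (fejer N a).
Proof. by move=> k x kN; rewrite /fejer fejer_weight_supp // mul0r. Qed.

Lemma fejer_limit_bound N n (e : R) : 0 < e ->
  (forall k x, cabs (u n k x - c k x) <= e) ->
  zbound (fun k => supnorm (Lsub (fejer N (u n)) (fejer N c) k)) (e *+ N.+1.*2).
Proof.
move=> e0 H; rewrite -fejerB; apply: zbound_supp; last exact: fejer_supp.
move=> k x; rewrite cabsM cabs_cofr ?fejer_weight_ge0 //.
by apply: le_trans (H k x); rewrite ler_piMl ?cabs_ge0 ?fejer_weight_le1.
Qed.

Lemma fejer_limit_L1 N : l1elt (fejer N c).
Proof.
have [n Hn] := hc ltr01.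
have zb := @fejer_limit_bound N n 1 ltr01 (Hn n (leqnn n)).
have wc k : contC (fejer N c k).
  exact: contCM (contC_cst (cofr (fejer_weight N k))) (@fourier_limit_cont k).
have wnL := L1_fejer N (uL n).
apply: (L1_of_sub wnL); apply: L1_intro zb => k.
exact: contCB (L1_cont wnL k) (wc k).
Qed.

Lemma fejer_limit_commutant N : commutant1 sigma sigmainv (fejer N c).
Proof.
apply/commutant1P; split; first exact: fejer_limit_L1.
move=> f hf n x; rewrite /fejer -mulrA fourier_limit_comm //; exact: mulrCA.
Qed.

(** The bound does not depend on [N]. A later term [u m] is inserted: contractivity of the Fejer
    mean handles [u n] against [u m], and for fixed [N] the finite support turns uniform convergence
    of coefficients into l^1-convergence as [m] grows. *)
Lemma fejer_limit_close (e : R) n N : 0 < e -> 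
  (forall m, (n <= m)%N -> regnorm (Lsub (u n) (u m)) <= e) ->
  regnorm (Lsub (fejer N (u n)) (fejer N c)) <= e.
Proof.
move=> e0 Hn; apply/ler_addgt0Pr => d d0.
have N0 : 0 < N.+1.*2%:R :> R by rewrite ltr0n.
have dN := divr_gt0 d0 N0.
have [M HM] := hc dN.
set m := maxn n M.
have wnL := L1_fejer N (uL n); have wmL := L1_fejer N (uL m); have wL := fejer_limit_L1 N.
apply: le_trans (regnorm_tri wnL wmL wL) _; apply: lerD.
  rewrite -fejerB; apply: le_trans (regnorm_fejer N (L1_sub (uL n) (uL m))) _.
  by apply: Hn; rewrite leq_maxl.
apply: le_trans (regnorm_le_N1 (L1_sub wmL wL)) _.
apply: le_trans (N1_le (@fejer_limit_bound N m _ dN (HM m (leq_maxr _ _)))) _.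
by rewrite -[leLHS]mulr_natr divfK // gt_eqF.
Qed.

Lemma fejer_limit_dense : exists v : nat -> Lelt R X,
  (forall n, commutant1 sigma sigmainv (v n)) /\
  (fun n => regnorm (Lsub (u n) (v n))) @ \oo --> (0 : R).
Proof.
have hex n : exists N, N1 (Lsub (u n) (fejer N (u n))) <= n.+1%:R^-1.
  by apply: fejer_approx => //; rewrite invr_gt0 ltr0Sn.
(* The order of the Fejer mean is adapted to [u n], where l^1-approximation is available;
   [fejer_limit_close] then replaces [u n] by [c] at any order. *)
have [F HF] := choice hex.
exists (fun n => fejer (F n) c); split; first by move=> n; exact: fejer_limit_commutant.
apply/cvgrPdist_lt => e e0.
have e2 : 0 < e / 2 by rewrite divr_gt0.
have [N HN] := ucauchy e2.
near=> n.
have Nn : (N <= n)%N by near: n; exists N.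
have n1 : n.+1%:R^-1 < e / 2.
  near: n; have /cvgrPdist_lt /(_ _ e2) := @cvg_harmonic R.
  by apply: filterS => n /=; rewrite sub0r normrN ger0_norm ?invr_ge0.
rewrite sub0r normrN ger0_norm ?regnorm_ge0 //.
have wL := fejer_limit_L1 (F n); have wnL := L1_fejer (F n) (uL n).
apply: le_lt_trans (regnorm_tri (uL n) wnL wL) _; rewrite [e]splitr.
apply: ltr_leD.
  by apply: le_lt_trans (regnorm_le_N1 (L1_sub (uL n) wnL)) (le_lt_trans (HF n) n1).
by apply: fejer_limit_close => // m nm; apply/ltW/HN => //; exact: leq_trans nm.
Unshelve. all: by end_near. Qed.

End Density.

End L1Algebra.

Theorem theorem5p1 (R : realType) (X : topologicalType) (sigma sigmainv : X -> X)
  (Xne : [set: X] !=set0) (Xcpt : compact [set: X]) (Xhaus : hausdorff_space X)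
  (sigma_cont : continuous sigma) (sigmainv_cont : continuous sigmainv)
  (sigmaK : cancel sigma sigmainv) (sigmainvK : cancel sigmainv sigma) :
  (* density: every element of C*(Sigma) (a ||.||_*-Cauchy sequence in l^1(Sigma))
     commuting with C(X) is a ||.||_*-limit of elements of C(X)'_1 *)
  (forall u : nat -> Lelt R X,
      (forall n, L1 (u n)) ->
      (forall e : R, 0 < e -> exists N : nat, forall m n : nat, (N <= m)%N -> (N <= n)%N ->
          cstarnorm sigma sigmainv (Lsub (u m) (u n)) < e) ->
      (forall f : X -> Cplx R, contC f ->
          (fun n => cstarnorm sigma sigmainv
             (Lsub (Lmul sigma sigmainv (u n) (Lemb f)) (Lmul sigma sigmainv (Lemb f) (u n)))) @ \oo --> 0) ->
      exists v : nat -> Lelt R X,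
        (forall n, commutant1 sigma sigmainv (v n)) /\
        (fun n => cstarnorm sigma sigmainv (Lsub (u n) (v n))) @ \oo --> 0)
  /\
  (* the enveloping C*-norm of C(X)'_1 is the restriction of the norm of C*(Sigma) *)
  (forall b : Lelt R X, commutant1 sigma sigmainv b ->
      envnorm sigma sigmainv (commutant1 sigma sigmainv) b = cstarnorm sigma sigmainv b).
Proof.
have nE a := @cstarnormE R X sigma sigmainv Xne Xcpt sigma_cont sigmainv_cont sigmaK sigmainvK a.
have mL a b := @L1_mul R X sigma sigmainv Xne Xcpt sigma_cont sigmainv_cont a b.
have sL a b := @L1_sub R X Xne Xcpt a b.
have gS := good_commutant1 R Xne Xcpt sigma_cont sigmainv_cont sigmaK sigmainvK.
split=> [u uL1 ucauchy ucomm|b bS]; last first.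
  have bL := good_L1 gS bS.
  by rewrite (envnorm_good Xne Xcpt sigma_cont sigmainv_cont sigmaK sigmainvK gS bS) (nE _ bL).
have uL n : l1elt (u n) by exact: L1elt.
have ucauchy' e : 0 < e -> exists N : nat, forall m n, (N <= m)%N -> (N <= n)%N ->
    regnorm sigma sigmainv (Lsub (u m) (u n)) < e.
  move=> e0; have [N HN] := ucauchy e e0; exists N => m n Nm Nn.
  by rewrite -(nE _ (sL _ _ (uL m) (uL n))); exact: HN.
have ucomm' f : contC f -> (fun n => regnorm sigma sigmainv
    (Lsub (Lmul sigma sigmainv (u n) (Lemb f)) (Lmul sigma sigmainv (Lemb f) (u n)))) @ \oo --> 0.
  move=> hf; have fL := L1_emb Xne Xcpt hf.
  rewrite (_ : (fun n => _) = fun n => cstarnorm sigma sigmainv (Lsub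
    (Lmul sigma sigmainv (u n) (Lemb f)) (Lmul sigma sigmainv (Lemb f) (u n)))).
    exact: ucomm.
  apply/funext => n.
  exact: (esym (nE _ (sL _ _ (mL _ _ (uL n) fL) (mL _ _ fL (uL n))))).
have [c hc] := fourier_limit Xne Xcpt uL ucauchy'.
have [v [vS hv]] :=
  fejer_limit_dense Xne Xcpt sigma_cont sigmainv_cont uL ucauchy' ucomm' hc.
exists v; split; first exact: vS.
rewrite (_ : (fun n => _) = fun n => regnorm sigma sigmainv (Lsub (u n) (v n))); first exact: hv.
by apply/funext => n; exact: nE _ (sL _ _ (uL n) (good_L1 gS (vS n))).
Qed.
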